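(* Let $(\Omega,\mathcal{F})$ be a measurable space, $T:\Omega\to\Omega$ measurable, and $V$ a $T$-invariant upper probability. The following are equivalent: (i) $V$ is weakly mixing; (ii) there exists $Q\in\operatorname{core}(V)\cap\mathcal{M}^{wm}(T)$ such that for every $P\in\operatorname{core}(V)$, $\lim_{n\to\infty}\frac{1}{n}\sum_{i=0}^{n-1}|P(B\cap T^{-i}C)-P(B)Q(C)|^2=0$ for all $B,C\in\mathcal{F}$; (iii) there exists $Q\in\operatorname{core}(V)\cap\mathcal{M}(T)$ such that for every $P\in\operatorname{core}(V)$, $\lim_{n\to\infty}\frac{1}{n}\sum_{i=0}^{n-1}|P(B\cap T^{-i}C)-P(B)Q(C)|^2=0$ for all $B,C\in\mathcal{F}$.
   Context: A capacity is a monotone map $\mu:\mathcal{F}\to[0,1]$ with $\mu(\emptyset)=0,\mu(\Omega)=1$. An upper probability is a capacity $V$ with $V(A)=\max_{P\in\Lambda}P(A)$ for a weak* (setwise convergence) compact set $\Lambda$ of probabilities; $\operatorname{core}(V)$ is the set of finitely additive normalized $P\le V$. A $T$-invariant capacity $\mu$ is weakly mixing if every measurable $f:\Omega\to\mathbb{C}$ with $f\circ T=\lambda f$ $\mu$-a.s. for some $\lambda\in\mathbb{C}$ is constant $\mu$-a.s. $\mathcal{M}(T)$: $T$-invariant probabilities; $\mathcal{M}^{wm}(T)$: those $P\in\mathcal{M}(T)$ with $P\times P$ ergodic for $T\times T$. *)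

(* Defs.v *)
From HB Require Import structures.
From mathcomp Require Import all_boot all_order all_algebra.
From mathcomp Require Import all_classical all_reals all_analysis.
From mathcomp Require Import complex.
Set Implicit Arguments. Unset Strict Implicit. Unset Printing Implicit Defensive.
Import Order.TTheory GRing.Theory Num.Theory.
Import numFieldNormedType.Exports.
Local Open Scope classical_set_scope.
Local Open Scope ring_scope.

Section Defs.
Context {d : measure_display} {Omega : measurableType d} {R : realType}.

(* A capacity: monotone normalized set function on the measurable sets,
   with values in [0,1]. Values on non-measurable sets are irrelevant. *)
Definition capacity (mu : set Omega -> R) : Prop :=
  mu set0 = 0 /\ mu setT = 1 /\
  (forall A, measurable A -> 0 <= mu A <= 1) /\
  (forall A B, measurable A -> measurable B -> A `<=` B -> mu A <= mu B).

(* Setwise-convergence (weak* ) topology on probabilities: the initial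
   topology of the evaluation map P |-> (A |-> P(A)) (A measurable) into the
   product space of real-valued functions on sets; a set of probabilities is
   compact in it iff its image under this map is compact. *)
Definition setwise_eval (P : probability Omega R) : {ptws set Omega -> R} :=
  fun A => if `[< measurable A >] then fine (P A) else 0.

Definition setwise_compact (Lambda : set (probability Omega R)) : Prop :=
  compact (setwise_eval @` Lambda).

Definition upper_probability (V : set Omega -> R) : Prop :=
  capacity V /\
  exists Lambda : set (probability Omega R),
    setwise_compact Lambda /\
    forall A, measurable A ->
      (forall P, Lambda P -> P A <= (V A)%:E)%E /\
      exists2 P, Lambda P & P A = (V A)%:E.

Definition core (V : set Omega -> R) (P : set Omega -> R) : Prop :=
  P set0 = 0 /\ P setT = 1 /\
  (forall A, measurable A -> 0 <= P A) /\
  (forall A B, measurable A -> measurable B -> A `&` B = set0 ->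
     P (A `|` B) = P A + P B) /\
  (forall A, measurable A -> P A <= V A).

Definition cap_invariant (T : Omega -> Omega) (mu : set Omega -> R) : Prop :=
  forall A, measurable A -> mu (T @^-1` A) = mu A.

Definition cap_as (mu : set Omega -> R) (p : Omega -> Prop) : Prop :=
  exists N, measurable N /\ mu N = 0 /\ forall x, ~ N x -> p x.

Definition measurable_C (f : Omega -> R[i]) : Prop :=
  measurable_fun setT (fun x => complex.Re (f x)) /\
  measurable_fun setT (fun x => complex.Im (f x)).

Definition cap_weakly_mixing (T : Omega -> Omega) (mu : set Omega -> R) : Prop :=
  forall (f : Omega -> R[i]) (lam : R[i]), measurable_C f ->
    cap_as mu (fun x => f (T x) = lam * f x) ->
    exists c : R[i], cap_as mu (fun x => f x = c).

Definition invariant_prob (T : Omega -> Omega) (P : probability Omega R) : Prop :=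
  forall A, measurable A -> P (T @^-1` A) = P A.

Definition weakly_mixing_prob (T : Omega -> Omega) (P : probability Omega R) : Prop :=
  invariant_prob T P /\
  forall A : set (Omega * Omega), measurable A ->
    (fun z => (T z.1, T z.2)) @^-1` A = A ->
    ((P \x P)%E A = 0%E \/ (P \x P)%E A = 1%E).

Definition mixing_cond (T : Omega -> Omega) (V : set Omega -> R)
    (Q : probability Omega R) : Prop :=
  forall P, core V P ->
  forall B C, measurable B -> measurable C ->
    (fun n : nat => n%:R^-1 *
       \sum_(i < n) `| P (B `&` (iter i T @^-1` C)) - P B * fine (Q C) | ^+ 2)
      @ \oo --> (0 : R).

End Defs.

(* Main.v *)
Require Import Defs.
From HB Require Import structures.
From mathcomp Require Import all_boot all_order all_algebra.
From mathcomp Require Import all_classical all_reals all_analysis.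
From mathcomp Require Import measurable_realfun complex lra ring.
Set Implicit Arguments. Unset Strict Implicit. Unset Printing Implicit Defensive.
Import Order.TTheory GRing.Theory Num.Theory.
Import numFieldNormedType.Exports.
Local Open Scope classical_set_scope.
Local Open Scope ring_scope.

(**
  A weakly mixing [V] is ergodic, and an invariant [Q] in its core, obtained as a
  Banach limit along the orbit, has the same null sets as [V]: if [Q N = 0], the
  set of points visiting [N] infinitely often is invariant, [Q]-null and has at
  least the capacity of [N]. The same holds under (iii), so everything reduces to
  the eigenfunctions of the single measure [Q], the other elements of the core
  being absolutely continuous with respect to it.

  Absence of eigenfunctions is turned into decay of correlations without the
  spectral theorem. For [f = 1_C - Q C] and an angle [t], the infimum of
  [E |sum_n p_n e^(int) f o T^n|^2] over the polynomials [p] with [p(1) = 1] is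
  approached by the Cesaro averages; were it positive, they would converge to
  an eigenfunction of mean [0]. So it vanishes for every [t], and by
  compactness of the circle the Cesaro averages tend to [0] in L^2 uniformly in
  [t]; Parseval then gives [n^-2 sum_(i,j<n) b(i,j)^2 -> 0] for the
  correlations [b(i,j) = E (f o T^i) (f o T^j)]. The mixing condition for all
  [P << Q] is a second moment computation from this; applied to rectangles in the
  product system, it gives the ergodicity of [Q x Q].

  Conversely, an eigenfunction [f] with eigenvalue in the closed unit disc does
  not spread a set on which its oscillation is small, whereas mixing sends
  positive parts of that set simultaneously to [Re f <= a] and to [Re f >= b].
*)

(** * Cesaro means and Banach limits *)

Lemma cvg_invn (R : realType) : (n%:R^-1 : R) @[n --> \oo] --> (0 : R).
Proof. by rewrite -(cvg_shiftS (fun n => n%:R^-1 : R)); exact: cvg_harmonic. Qed.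

Section cesaro_mean.
Context {R : realType}.
Implicit Types (u v : nat -> R) (b : nat -> nat -> R) (c : R) (n : nat).

(* The library's [arithmetic_mean] averages the first [n.+1] terms instead. *)
Definition cesaro_mean u n : R := n%:R^-1 * \sum_(i < n) u i.

Definition cesaro_mean2 b n : R := cesaro_mean (fun i => cesaro_mean (b i) n) n.

Lemma cesaro_meanD u v n :
  cesaro_mean (fun i => u i + v i) n = cesaro_mean u n + cesaro_mean v n.
Proof. by rewrite /cesaro_mean big_split mulrDr. Qed.

Lemma cesaro_meanZ c u n :
  cesaro_mean (fun i => c * u i) n = c * cesaro_mean u n.
Proof. by rewrite /cesaro_mean -mulr_sumr mulrCA. Qed.

Lemma cesaro_meanB u v n :
  cesaro_mean (fun i => u i - v i) n = cesaro_mean u n - cesaro_mean v n.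
Proof. by rewrite /cesaro_mean sumrB mulrBr. Qed.

Lemma cesaro_mean_cst c n : (0 < n)%N -> cesaro_mean (fun=> c) n = c.
Proof.
move=> n0; rewrite /cesaro_mean sumr_const card_ord -[c *+ n]mulr_natl mulKf//.
by rewrite pnatr_eq0 -lt0n.
Qed.

Lemma le_cesaro_mean u v n : (forall i, u i <= v i) ->
  cesaro_mean u n <= cesaro_mean v n.
Proof. by move=> uv; rewrite ler_wpM2l ?invr_ge0// ler_sum. Qed.

Lemma cesaro_mean_ge0 u n : (forall i, 0 <= u i) -> 0 <= cesaro_mean u n.
Proof. by move=> u0; rewrite mulr_ge0 ?invr_ge0// sumr_ge0. Qed.

Lemma norm_cesaro_mean_le u c n : (forall i, `|u i| <= c) -> `|cesaro_mean u n| <= c.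
Proof.
move=> uc; have c0 : 0 <= c by exact: le_trans (uc 0%N).
case: n => [|n]; first by rewrite /cesaro_mean invr0 mul0r normr0.
rewrite -[leRHS](cesaro_mean_cst c (ltn0Sn n)) /cesaro_mean normrM ger0_norm ?invr_ge0//.
by rewrite ler_wpM2l ?invr_ge0// (le_trans (ler_norm_sum _ _ _))// ler_sum.
Qed.

Lemma cesaro_meanS_subr u n :
  cesaro_mean (fun i => u i.+1) n - cesaro_mean u n = n%:R^-1 * (u n - u 0%N).
Proof.
rewrite -cesaro_meanB /cesaro_mean -(big_mkord xpredT (fun i => u i.+1 - u i)).
by rewrite telescope_sumr.
Qed.

Lemma cesaro_meanS_subr_cvg0 u c : (forall i, `|u i| <= c) ->
  cesaro_mean (fun i => u i.+1) n - cesaro_mean u n @[n --> \oo] --> (0 : R).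
Proof.
move=> uc; under eq_cvg do rewrite cesaro_meanS_subr.
have cn0 : n%:R^-1 * (c + c) @[n --> \oo] --> (0 : R).
  by rewrite -[X in _ --> X](mul0r (c + c)); apply: cvgMr_tmp; exact: cvg_invn.
apply/norm_cvg0P; apply: squeeze_cvgr (cvg_cst 0) cn0; apply: nearW => n.
rewrite normr_ge0 normrM ger0_norm ?invr_ge0// ler_wpM2l ?invr_ge0//.
by rewrite (le_trans (ler_normB _ _))// lerD.
Qed.

(* The variance of the uniform distribution on the first [n] terms is nonnegative. *)
Lemma sqr_cesaro_mean_le u n :
  cesaro_mean u n ^+ 2 <= cesaro_mean (fun i => u i ^+ 2) n.
Proof.
case: n => [|n]; first by rewrite /cesaro_mean invr0 !mul0r expr0n.
set m := cesaro_mean u n.+1.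
have : 0 <= cesaro_mean (fun i => u i ^+ 2 - (2 * m * u i - m ^+ 2)) n.+1.
  apply: cesaro_mean_ge0 => i.
  by rewrite (_ : _ - _ = (u i - m) ^+ 2) ?sqr_ge0//; ring.
rewrite !cesaro_meanB cesaro_meanZ cesaro_mean_cst// -/m.
by rewrite (_ : 2 * m * m - m ^+ 2 = m ^+ 2) ?subr_ge0//; ring.
Qed.

Lemma cesaro_mean_cvg0_exists_lt u c : cesaro_mean u @ \oo --> (0 : R) -> 0 < c ->
  exists i, u i < c.
Proof.
move=> u0 c0; apply: contrapT => /forallNP uc.
have [n _ /(_ n.+1 (leqnSn n))] := cvgr_lt _ u0 _ c0.
rewrite /= ltNge -{1}[c](cesaro_mean_cst c (ltn0Sn n)) le_cesaro_mean// => i.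
by rewrite leNgt; exact/negP.
Qed.

Lemma cesaro_mean2E b n :
  cesaro_mean2 b n = n%:R ^- 2 * \sum_(i < n) \sum_(j < n) b i j.
Proof.
by rewrite /cesaro_mean2 /cesaro_mean -mulr_sumr mulrA -expr2 exprVn.
Qed.

Lemma cesaro_mean2D b b' n : cesaro_mean2 (fun i j => b i j + b' i j) n =
  cesaro_mean2 b n + cesaro_mean2 b' n.
Proof.
rewrite /cesaro_mean2 -cesaro_meanD; congr cesaro_mean; apply/funext => i.
exact: cesaro_meanD.
Qed.

Lemma le_cesaro_mean2 b b' n : (forall i j, b i j <= b' i j) ->
  cesaro_mean2 b n <= cesaro_mean2 b' n.
Proof. by move=> bb; apply: le_cesaro_mean => i; exact: le_cesaro_mean. Qed.

Lemma cesaro_mean2_ge0 b n : (forall i j, 0 <= b i j) -> 0 <= cesaro_mean2 b n.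
Proof. by move=> b0; apply: cesaro_mean_ge0 => i; exact: cesaro_mean_ge0. Qed.

Lemma sqr_cesaro_mean u n :
  cesaro_mean u n ^+ 2 = cesaro_mean2 (fun i j => u i * u j) n.
Proof.
rewrite expr2 /cesaro_mean2 -cesaro_meanZ; congr cesaro_mean; apply/funext => i.
by rewrite mulrC cesaro_meanZ.
Qed.

Lemma cesaro_mean2_norm_cvg0 b :
  cesaro_mean2 (fun i j => b i j ^+ 2) @ \oo --> (0 : R) ->
  cesaro_mean2 (fun i j => `|b i j|) @ \oo --> (0 : R).
Proof.
move=> b0; have sqrt0 : Num.sqrt (cesaro_mean2 (fun i j => b i j ^+ 2) n)
    @[n --> \oo] --> (0 : R).
  by rewrite -[X in _ --> X]sqrtr0; exact: (continuous_cvg _ (@sqrt_continuous R 0) b0).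
apply: squeeze_cvgr (cvg_cst 0) sqrt0; apply: nearW => n.
rewrite cesaro_mean2_ge0//= -[leLHS]ger0_norm ?cesaro_mean2_ge0// -sqrtr_sqr.
apply: ler_wsqrtr; apply: le_trans (sqr_cesaro_mean_le _ _) _.
apply: le_cesaro_mean => i; apply: le_trans (sqr_cesaro_mean_le _ _) _.
by apply: le_cesaro_mean => j; rewrite (real_normK (num_real _)).
Qed.

End cesaro_mean.

Lemma fmap_ultra (X Y : Type) (f : X -> Y) (F : set_system X) :
  UltraFilter F -> UltraFilter (f @ F).
Proof.
move=> FU; split; first exact: fmap_proper_filter.
move=> G GP FG; apply/seteqP; split; last exact: FG.
move=> A GA; have [//|FCA] := @in_ultra_setVsetC _ F (f @^-1` A) FU.
by have /filter_ex[y []] : G (A `&` ~` A) by apply: filterI => //; exact: FG.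
Qed.

Section banach_limit.
Context {R : realType}.
Implicit Types (u v : nat -> R) (c l : R).

Definition ultra_infty : set_system nat :=
  sval (cid (ultraFilterLemma eventually_filter)).

#[local] Instance ultra_infty_ultra : UltraFilter ultra_infty.
Proof. by have [] := svalP (cid (ultraFilterLemma eventually_filter)). Qed.

Lemma ultra_infty_eventually : eventually `<=` ultra_infty.
Proof. by have [] := svalP (cid (ultraFilterLemma eventually_filter)). Qed.

Definition banach_limit u : R := lim (cesaro_mean u @ ultra_infty).

Let cvg_banach_limit u c : (forall i, `|u i| <= c) ->
  cesaro_mean u @ ultra_infty --> banach_limit u.
Proof.
move=> uc; have := @segment_compact R (- c) c; rewrite compact_ultra.
move=> /(_ (cesaro_mean u @ ultra_infty) (fmap_ultra _ _)).
case=> [|l [_ ul]]; last by apply/cvgP: ul.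
apply: (@filterE _ ultra_infty) => n.
by rewrite /= in_itv/= -ler_norml norm_cesaro_mean_le.
Qed.

Lemma banach_limit_cst c : banach_limit (fun=> c) = c.
Proof.
apply: cvg_lim => //; apply: cvg_near_cst; apply: ultra_infty_eventually.
by exists 1%N => // n /= n0; exact: cesaro_mean_cst.
Qed.

Lemma banach_limitD u v c c' : (forall i, `|u i| <= c) -> (forall i, `|v i| <= c') ->
  banach_limit (fun i => u i + v i) = banach_limit u + banach_limit v.
Proof.
move=> uc vc; apply: cvg_lim => //; under eq_cvg do rewrite cesaro_meanD.
by apply: cvgD; [exact: cvg_banach_limit uc|exact: cvg_banach_limit vc].
Qed.

Lemma le_banach_limit u v c c' : (forall i, `|u i| <= c) -> (forall i, `|v i| <= c') ->
  (forall i, u i <= v i) -> banach_limit u <= banach_limit v.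
Proof.
move=> uc vc uv; apply: ler_cvg_to (cvg_banach_limit uc) (cvg_banach_limit vc) _.
by apply: filterE => n; exact: le_cesaro_mean.
Qed.

Lemma banach_limitS u c : (forall i, `|u i| <= c) ->
  banach_limit (fun i => u i.+1) = banach_limit u.
Proof.
move=> uc; apply: cvg_lim => //.
have du : cesaro_mean (fun i => u i.+1) n - cesaro_mean u n
    @[n --> ultra_infty] --> (0 : R).
  by move=> A /(cesaro_meanS_subr_cvg0 uc); exact: ultra_infty_eventually.
rewrite -[X in _ --> X]add0r.
under eq_cvg => n do rewrite -[cesaro_mean _ n](subrK (cesaro_mean u n)).
by apply: cvgD => //; exact: cvg_banach_limit uc.
Qed.

End banach_limit.

(** * Bounded random variables *)

Section probability_values.
Context {d : measure_display} {Omega : measurableType d} {R : realType}.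
Variable P : probability Omega R.
Implicit Types A B : set Omega.

Lemma fine_prob_ge0 A : 0 <= fine (P A).
Proof. exact: fine_ge0. Qed.

Lemma fine_probK A : measurable A -> (fine (P A))%:E = P A.
Proof. by move=> mA; rewrite fineK// fin_num_measure. Qed.

Lemma fine_prob_le1 A : measurable A -> fine (P A) <= 1.
Proof. by move=> mA; rewrite -lee_fin fine_probK// probability_le1. Qed.

Lemma norm_fine_prob_le1 A : measurable A -> `|fine (P A)| <= 1.
Proof. by move=> mA; rewrite ger0_norm ?fine_prob_ge0 ?fine_prob_le1. Qed.

Lemma fine_probU A B : measurable A -> measurable B -> A `&` B = set0 ->
  fine (P (A `|` B)) = fine (P A) + fine (P B).
Proof.
move=> mA mB AB; apply: EFin_inj; rewrite EFinD !fine_probK ?measureU//.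
exact: measurableU.
Qed.

Lemma fine_prob_eq0 A : measurable A -> (fine (P A) = 0) <-> (P A = 0%E).
Proof. by move=> mA; rewrite -(fine_probK mA); split => [/= ->|[]]. Qed.

Lemma fine_prob_le0 A : measurable A -> fine (P A) <= 0 -> P A = 0%E.
Proof.
move=> mA A0; apply/fine_prob_eq0 => //; apply/eqP.
by rewrite eq_le A0 fine_prob_ge0.
Qed.

Lemma fine_prob_gt0 A : measurable A -> (0 < fine (P A)) = (P A != 0%E).
Proof.
move=> mA; rewrite lt_neqAle fine_prob_ge0 andbT eq_sym; congr (~~ _).
by apply/eqP/eqP => /(fine_prob_eq0 mA).
Qed.

Lemma prob_bigcap_nonincreasing_ge (F : nat -> set Omega) (v : R) :
  (forall n, measurable (F n)) -> nonincreasing_seq F ->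
  (forall n, v <= fine (P (F n))) -> v <= fine (P (\bigcap_n F n)).
Proof.
move=> mF niF vF.
have mI : measurable (\bigcap_n F n) by exact: bigcap_measurable.
have PF : P \o F @ \oo --> P (\bigcap_n F n).
  apply: nonincreasing_cvg_mu => //.
  by apply: le_lt_trans (probability_le1 P (mF 0%N)) _; exact: ltry.
rewrite -lee_fin fine_probK// -(cvg_lim _ PF)//.
apply: lime_ge; first by apply: cvgP PF.
by apply: nearW => n /=; rewrite -fine_probK ?lee_fin.
Qed.

Lemma exists_prob_gt0_of_cover (I : countType) (A : set Omega) (F : I -> set Omega) :
  measurable A -> (forall i, measurable (F i)) -> 0 < fine (P A) ->
  A `<=` \bigcup_i F i -> exists i, 0 < fine (P (A `&` F i)).
Proof.
move=> mA mF; rewrite fine_prob_gt0// => /eqP A0 AF; apply: contrapT => /forallNP nF.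
apply: A0; apply/(negligibleP _ mA); apply: (@negligibleS _ _ _ P
    (\bigcup_n (if unpickle n is Some i then A `&` F i else set0))).
  by move=> x Ax; have [i _ Fx] := AF x Ax; exists (pickle i) => //; rewrite pickleK.
apply: negligible_bigcup => n; case: unpickle => [i|]; last exact: negligible_set0.
have mAF : measurable (A `&` F i) by exact: measurableI.
apply/(negligibleP _ mAF)/fine_prob_le0 => //.
by rewrite leNgt; exact/negP.
Qed.

Lemma ae_exists_prob_gt0 A (p : Omega -> Prop) : measurable A -> 0 < fine (P A) ->
  {ae P, forall x, p x} -> exists2 x, A x & p x.
Proof.
move=> mA; rewrite fine_prob_gt0// => /eqP A0 [N [mN N0 pN]].
apply: contrapT => nex; apply/A0/(subset_measure0 mA mN _ N0) => x Ax.
by apply: pN => px; apply: nex; exists x.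
Qed.

End probability_values.

Lemma prob_dominates_epsilon_delta {d : measure_display} {Omega : measurableType d}
    {R : realType} (P Q : probability Omega R) (e : R) :
  P `<< Q -> 0 < e ->
  exists2 r, 0 < r & forall A, measurable A -> fine (Q A) < r -> fine (P A) < e.
Proof.
move=> PQ e0; have [X [Y XY]] := Hahn_decomposition (charge_of_finite_measure P).
have [r [r0 rP]] := charge_variation_continuous XY PQ e0.
exists r => // A mA QA; have {}QA : (Q A < r%:E)%E by rewrite -fine_probK ?lte_fin.
rewrite -lte_fin fine_probK//; apply: le_lt_trans (rP A mA QA).
by have := abse_charge_variation XY mA; rewrite gee0_abs.
Qed.

Section bounded_measurable_functions.
Context {d : measure_display} {Omega : measurableType d} {R : realType}.
Implicit Types (f g : Omega -> R) (F : nat -> Omega -> R) (A : set Omega) (c : R).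

Lemma measurable_le_cst f c : measurable_fun setT f -> measurable [set x | f x <= c].
Proof.
by move=> mf; rewrite -[X in measurable X]setTI; exact: measurable_fun_le.
Qed.

Lemma measurable_ge_cst f c : measurable_fun setT f -> measurable [set x | c <= f x].
Proof.
by move=> mf; rewrite -[X in measurable X]setTI; exact: measurable_fun_le.
Qed.

Lemma norm_indic_le1 A x : `|\1_A x : R| <= 1.
Proof. by rewrite indicE normr_nat; case: (_ \in _); rewrite ?ler01. Qed.

Definition bounded_mfun f :=
  measurable_fun setT f /\ exists M, forall x, `|f x| <= M.

Lemma bounded_mfun_cst c : bounded_mfun (fun=> c).
Proof. by split; [exact: measurable_cst|exists `|c|]. Qed.

Lemma bounded_mfunD f g : bounded_mfun f -> bounded_mfun g ->
  bounded_mfun (fun x => f x + g x).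
Proof.
move=> [mf [M fM]] [mg [N gN]]; split; first exact: measurable_funD.
by exists (M + N) => x; rewrite (le_trans (ler_normD _ _))// lerD.
Qed.

Lemma bounded_mfunM f g : bounded_mfun f -> bounded_mfun g ->
  bounded_mfun (fun x => f x * g x).
Proof.
move=> [mf [M fM]] [mg [N gN]]; split; first exact: measurable_funM.
by exists (M * N) => x; rewrite normrM ler_pM.
Qed.

Lemma bounded_mfunZ c f : bounded_mfun f -> bounded_mfun (fun x => c * f x).
Proof. by move=> bf; apply: bounded_mfunM => //; exact: bounded_mfun_cst. Qed.

Lemma bounded_mfunB f g : bounded_mfun f -> bounded_mfun g ->
  bounded_mfun (fun x => f x - g x).
Proof.
move=> bf bg; apply: bounded_mfunD => //.
by under eq_fun do rewrite -mulN1r; exact: bounded_mfunZ.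
Qed.

Lemma bounded_mfun_sqr f : bounded_mfun f -> bounded_mfun (fun x => f x ^+ 2).
Proof. by move=> bf; exact: (bounded_mfunM bf bf). Qed.

Lemma bounded_mfun_norm f : bounded_mfun f -> bounded_mfun (fun x => `|f x|).
Proof.
move=> [mf [M fM]]; split; first exact: measurableT_comp.
by exists M => x; rewrite normr_id.
Qed.

Lemma bounded_mfun_sum (I : Type) (r : seq I) (G : I -> Omega -> R) :
  (forall i, bounded_mfun (G i)) -> bounded_mfun (fun x => \sum_(i <- r) G i x).
Proof.
move=> bG; elim: r => [|i r ih].
  by under eq_fun do rewrite big_nil; exact: bounded_mfun_cst.
by under eq_fun do rewrite big_cons; exact: bounded_mfunD.
Qed.

Lemma bounded_mfun_cesaro_mean F n : (forall i, bounded_mfun (F i)) ->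
  bounded_mfun (fun x => cesaro_mean (F ^~ x) n).
Proof. by move=> bF; apply: bounded_mfunZ; exact: bounded_mfun_sum. Qed.

Lemma bounded_mfun_indic A : measurable A -> bounded_mfun \1_A.
Proof.
by move=> mA; split; [exact: measurable_indic|exists 1 => x; exact: norm_indic_le1].
Qed.

Lemma bounded_mfun_comp f T : measurable_fun setT T -> bounded_mfun f ->
  bounded_mfun (fun x => f (T x)).
Proof.
by move=> mT [mf [M fM]]; split; [exact: measurableT_comp|exists M => x].
Qed.

(* The limit superior is measurable and extends every pointwise limit. *)
Lemma exists_measurable_limit F (M : R) : (forall n, measurable_fun setT (F n)) ->
  (forall n x, `|F n x| <= M) ->
  exists2 f : Omega -> R, measurable_fun setT f &
    forall x (l : R), F ^~ x @ \oo --> l -> f x = l.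
Proof.
move=> mF FM; exists (fun x => limn_sup (F ^~ x)); last first.
  by move=> x l Fl; have [_ ->] := cvg_limn_inf_sup Fl.
by apply: measurable_fun_limn_sup => // x _; [exists M|exists (- M)] => _ [n _ <-];
  have := FM n x; rewrite ler_norml => /andP[].
Qed.

Section expectation.
Variable P : probability Omega R.

Local Notation "''E' f" := (Rintegral P setT f) (at level 10, f at level 8).

Lemma bounded_mfun_integrable f : bounded_mfun f ->
  P.-integrable setT (EFin \o f).
Proof.
move=> [mf [M fM]]; apply: measurable_bounded_integrable => //.
  by rewrite [X in (X < _)%E](probability_setT P) ltry.
by exists M; split; [exact: num_real|move=> N MN x _ /=; exact: le_trans (ltW MN)].
Qed.

Lemma expect_cst c : 'E (fun=> c) = c.
Proof. by rewrite Rintegral_cst// [X in fine X](probability_setT P) /= mulr1. Qed.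

Lemma expectD f g : bounded_mfun f -> bounded_mfun g ->
  'E (fun x => f x + g x) = 'E f + 'E g.
Proof. by move=> bf bg; rewrite RintegralD//; exact: bounded_mfun_integrable. Qed.

Lemma expectB f g : bounded_mfun f -> bounded_mfun g ->
  'E (fun x => f x - g x) = 'E f - 'E g.
Proof. by move=> bf bg; rewrite RintegralB//; exact: bounded_mfun_integrable. Qed.

Lemma expectZ c f : bounded_mfun f -> 'E (fun x => c * f x) = c * 'E f.
Proof. by move=> bf; rewrite RintegralZl//; exact: bounded_mfun_integrable. Qed.

Lemma expect_sum (I : Type) (r : seq I) (G : I -> Omega -> R) :
  (forall i, bounded_mfun (G i)) ->
  'E (fun x => \sum_(i <- r) G i x) = \sum_(i <- r) 'E (G i).
Proof.
move=> bG; elim: r => [|i r ih].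
  by under eq_Rintegral do rewrite big_nil; rewrite expect_cst big_nil.
under eq_Rintegral do rewrite big_cons.
by rewrite big_cons expectD ?ih//; exact: bounded_mfun_sum.
Qed.

Lemma expect_cesaro_mean F n : (forall i, bounded_mfun (F i)) ->
  'E (fun x => cesaro_mean (F ^~ x) n) = cesaro_mean (fun i => 'E (F i)) n.
Proof.
by move=> bF; rewrite /cesaro_mean expectZ ?expect_sum//; exact: bounded_mfun_sum.
Qed.

Lemma expect_cesaro_mean2 (G : nat -> nat -> Omega -> R) n :
  (forall i j, bounded_mfun (G i j)) ->
  'E (fun x => cesaro_mean2 (fun i j => G i j x) n) =
  cesaro_mean2 (fun i j => 'E (G i j)) n.
Proof.
move=> bG; rewrite /cesaro_mean2.
rewrite (expect_cesaro_mean (F := fun i x => cesaro_mean (fun j => G i j x) n)).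
  by congr cesaro_mean; apply/funext => i; exact: expect_cesaro_mean.
by move=> i; exact: bounded_mfun_cesaro_mean.
Qed.

Lemma expect_ge0 f : (forall x, 0 <= f x) -> 0 <= 'E f.
Proof. by move=> f0; apply: Rintegral_ge0. Qed.

Lemma le_expect f g : bounded_mfun f -> bounded_mfun g ->
  (forall x, f x <= g x) -> 'E f <= 'E g.
Proof.
by move=> bf bg fg; apply: le_Rintegral => //; exact: bounded_mfun_integrable.
Qed.

Lemma norm_expect_le f : bounded_mfun f -> `|'E f| <= 'E (fun x => `|f x|).
Proof. by move=> bf; apply: le_normr_Rintegral => //; exact: bounded_mfun_integrable. Qed.

Lemma expect_indic A : measurable A -> 'E \1_A = fine (P A).
Proof. by move=> mA; rewrite /Rintegral integral_indic// setIT. Qed.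

Lemma chebyshev_sqr f c : bounded_mfun f -> 0 < c ->
  fine (P [set x | c <= `|f x|]) <= 'E (fun x => f x ^+ 2) / c ^+ 2.
Proof.
move=> bf c0.
have mA : measurable [set x | c <= `|f x|].
  by apply: measurable_ge_cst; have [] := bounded_mfun_norm bf.
rewrite -expect_indic// ler_pdivlMr ?exprn_gt0// mulrC -expectZ;
  last exact: bounded_mfun_indic.
apply: le_expect => [||x]; first exact/bounded_mfunZ/bounded_mfun_indic.
  exact: bounded_mfun_sqr.
rewrite indicE; case: (boolP (x \in _)) => [/set_mem /= cx|_];
  last by rewrite mulr0 sqr_ge0.
by rewrite mulr1 -(real_normK (num_real (f x))) ler_sqr ?nnegrE// ltW.
Qed.

Lemma expect_norm_le_prob f c (M : R) : bounded_mfun f -> (forall x, `|f x| <= M) ->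
  0 <= c -> 'E (fun x => `|f x|) <= c + M * fine (P [set x | c <= `|f x|]).
Proof.
move=> bf fM c0; set S := [set x | c <= `|f x|].
have mS : measurable S.
  by apply: measurable_ge_cst; have [] := bounded_mfun_norm bf.
have bS : bounded_mfun (fun x => M * \1_S x).
  exact/bounded_mfunZ/bounded_mfun_indic.
have -> : c + M * fine (P S) = 'E (fun x => c + M * \1_S x).
  rewrite expectD ?expect_cst ?expectZ ?expect_indic//; first exact: bounded_mfun_indic.
  exact: bounded_mfun_cst.
apply: le_expect => [||x]; first exact: bounded_mfun_norm.
  by apply: bounded_mfunD => //; exact: bounded_mfun_cst.
rewrite indicE; case: (boolP (x \in S)) => [_|].
  by rewrite mulr1 (le_trans (fM x))// lerDr.
by rewrite notin_setE/= mulr0 addr0 => /negP; rewrite -ltNge => /ltW.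
Qed.

Lemma expect_cvg F f (M : R) :
  (forall n, measurable_fun setT (F n)) -> measurable_fun setT f ->
  (forall n x, `|F n x| <= M) ->
  {ae P, forall x, F n x @[n --> \oo] --> f x} ->
  'E (F n) @[n --> \oo] --> 'E f.
Proof.
move=> mF mf FM Ff.
have [] := @dominated_convergence _ _ _ P setT measurableT
    (fun n x => (F n x)%:E) (EFin \o f) (cst M%:E).
- by move=> n; apply/measurable_EFinP.
- exact/measurable_EFinP.
- by apply: filterS Ff => x Fx _; apply: cvg_EFin => //; exact: nearW.
- exact: (bounded_mfun_integrable (bounded_mfun_cst M)).
- by apply: aeW => x n _; rewrite /= lee_fin.
move=> intf _; rewrite -[X in _ --> X]fineK; last exact: integrable_fin_num.
by move/fine_cvg.
Qed.

End expectation.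
End bounded_measurable_functions.

Lemma cvgn_geometric_increments (R : realType) (u : nat -> R) :
  (\forall n \near \oo, `|u n - u n.+1| <= 2^-1 ^+ n) -> cvgn u.
Proof.
move=> [m _ um]; pose v n := u (n + m)%N.
suff : cvgn v by move=> /cvg_ex[l vl]; apply/cvg_ex; exists l; rewrite -(cvg_shiftn m).
have seriesE n : series (telescope v) n = v n - v 0%N by rewrite /series/= telescope_sumr.
have : cvgn (series (telescope v)).
  apply: normed_cvg; apply: (@series_le_cvg _ _ (geometric 1 2^-1)).
  - by move=> n /=; exact: normr_ge0.
  - by move=> n; rewrite /= mul1r exprn_ge0 ?invr_ge0.
  - move=> n; rewrite /= mul1r distrC (le_trans (um _ (leq_addl _ _)))//.
    by rewrite exprD ler_piMr ?exprn_ge0 ?invr_ge0// exprn_ile1 ?invr_ge0// invf_le1//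
      ler1n.
  - by apply: is_cvg_geometric_series; rewrite ger0_norm ?invr_ge0// invf_lt1// ltr1n.
move=> /cvg_ex[l sl]; apply/cvg_ex; exists (l + u m).
have -> : v = (fun n => series (telescope v) n + u m).
  by apply/funext => n; rewrite seriesE subrK.
by apply: cvgD; [exact: sl|exact: cvg_cst].
Qed.

Section mean_square.
Context {d : measure_display} {Omega : measurableType d} {R : realType}.
Variable P : probability Omega R.
Implicit Types (F : nat -> Omega -> R) (c M : R).

Local Notation "''E' f" := (Rintegral P setT f) (at level 10, f at level 8).

(* Chebyshev and Borel-Cantelli. *)
Lemma ae_cvgn_fast_mean_square F M : (forall n, bounded_mfun (F n)) ->
  (forall n, 'E (fun x => (F n x - F n.+1 x) ^+ 2) <= M * 8^-1 ^+ n) ->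
  {ae P, forall x, cvgn (F ^~ x)}.
Proof.
move=> bF FM; pose E n := [set x | 2^-1 ^+ n <= `|F n x - F n.+1 x|].
have mE n : measurable (E n).
  apply: measurable_ge_cst.
  by have [] := bounded_mfun_norm (bounded_mfunB (bF n) (bF n.+1)).
have PE n : (P (E n) <= (2 * M / (2 ^ (n + 1))%:R)%:E)%E.
  have h0 : 0 < 2^-1 ^+ n :> R by rewrite exprn_gt0// invr_gt0.
  rewrite -fine_probK// lee_fin.
  apply: le_trans (chebyshev_sqr P (bounded_mfunB (bF n) (bF n.+1)) h0) _.
  rewrite ler_pdivrMr ?exprn_gt0//; apply: le_trans (FM n) _.
  have -> : 8^-1 ^+ n = (2^-1 ^+ n) ^+ 3 :> R.
    by rewrite -exprM mulnC exprM; congr (_ ^+ _); field.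
  rewrite (_ : _ * _ = 2 * M / (2 ^ (n + 1))%:R * (2^-1 ^+ n) ^+ 2)//.
  by rewrite addn1 expnS natrM natrX !exprVn; field; rewrite expf_neq0.
exists (lim_sup_set E); split.
- by apply: bigcap_measurable => // n _; exact: bigcup_measurable.
- apply: lim_sup_set_cvg0 => //.
  apply: (@le_lt_trans _ _ (\sum_(0 <= n <oo) (2 * M / (2 ^ (n + 1))%:R)%:E)%E).
    by apply: lee_nneseries => // n _; exact: PE.
  by have /cvg_lim -> := @cvg_geometric_eseries_half R (2 * M) 0; rewrite ?ltry.
- move=> x /= ncvg n _; apply: contrapT => nE; apply: ncvg.
  apply: cvgn_geometric_increments; exists n => // k /= nk; rewrite leNgt.
  by apply/negP => /ltW Ek; apply: nE; exists k.
Qed.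

Lemma expect_cvg_cst F c M : (forall n, measurable_fun setT (F n)) ->
  (forall n x, `|F n x| <= M) -> {ae P, forall x, F n x @[n --> \oo] --> c} ->
  'E (F n) @[n --> \oo] --> c /\ 'E (fun x => F n x ^+ 2) @[n --> \oo] --> c ^+ 2.
Proof.
move=> mF FM Fc; split.
  by rewrite -(expect_cst P c); apply: expect_cvg FM Fc => //; exact: measurable_cst.
rewrite -(expect_cst P (c ^+ 2)); apply: (@expect_cvg _ _ _ _ _ _ (M ^+ 2)) => //.
- by move=> n; exact: measurable_funX.
- by move=> n x; rewrite normrX lerXn2r ?nnegrE// (le_trans _ (FM n x)).
- by apply: filterS Fc => x Fx; under eq_cvg do rewrite expr2; exact: cvgM.
Qed.

Lemma expect_sqr_cesaro_mean_cvg0 F (a : nat -> R) :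
  (forall i, bounded_mfun (F i)) -> (forall i, `|a i| <= 1) ->
  cesaro_mean2 (fun i j => `|'E (fun x => F i x * F j x)|) @ \oo --> (0 : R) ->
  'E (fun x => cesaro_mean (fun i => a i * F i x) n ^+ 2) @[n --> \oo] --> (0 : R).
Proof.
move=> bF a1 FF0; apply: squeeze_cvgr (cvg_cst 0) FF0; apply: nearW => n.
rewrite expect_ge0/= => [|x]; last exact: sqr_ge0.
have bFF i j : bounded_mfun (fun x => F i x * F j x) by exact: bounded_mfunM.
under eq_Rintegral do rewrite sqr_cesaro_mean.
rewrite (@expect_cesaro_mean2 _ _ _ P (fun i j x => a i * F i x * (a j * F j x))).
  apply: le_cesaro_mean2 => i j.
  under eq_Rintegral do rewrite mulrACA.
  rewrite expectZ// (le_trans (ler_norm _))// normrM ler_piMl//.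
  by rewrite normrM mulr_ile1.
by move=> i j; apply: bounded_mfunM; exact: bounded_mfunZ.
Qed.

Lemma dominated_expect_norm_cvg0 (Q : probability Omega R) F M : P `<< Q ->
  (forall n, measurable_fun setT (F n)) -> (forall n x, `|F n x| <= M) ->
  \int[Q]_x (F n x ^+ 2) @[n --> \oo] --> (0 : R) ->
  'E (fun x => `|F n x|) @[n --> \oo] --> (0 : R).
Proof.
move=> PQ mF FM F0; have bF n : bounded_mfun (F n) by split; last exists M.
have FnormM n x : `|F n x| <= `|M| by rewrite (le_trans (FM n x))// ler_norm.
apply/cvgrPdist_le => e e0.
pose c := e / (1 + `|M|); have c0 : 0 < c by rewrite divr_gt0.
have [r r0 Pr] := prob_dominates_epsilon_delta PQ c0.
have small : \forall n \near \oo, \int[Q]_x (F n x ^+ 2) < r * c ^+ 2.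
  by apply: (cvgr_lt _ F0); rewrite mulr_gt0// exprn_gt0.
apply: filterS small => n Fn; rewrite sub0r normrN ger0_norm ?expect_ge0//.
have mS : measurable [set x | c <= `|F n x|].
  by apply: measurable_ge_cst; have [] := bounded_mfun_norm (bF n).
have PS : fine (P [set x | c <= `|F n x|]) <= c.
  apply/ltW/Pr => //; apply: le_lt_trans (chebyshev_sqr Q (bF n) c0) _.
  by rewrite ltr_pdivrMr// exprn_gt0.
apply: le_trans (expect_norm_le_prob P (bF n) (FnormM n) (ltW c0)) _.
rewrite (_ : e = c + `|M| * c); last by rewrite /c; field; rewrite gt_eqF.
by rewrite lerD2l ler_wpM2l.
Qed.

Lemma dominated_expectM_cvg0 (Q : probability Omega R) F M (g : Omega -> R) :
  P `<< Q -> (forall n, measurable_fun setT (F n)) -> (forall n x, `|F n x| <= M) ->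
  \int[Q]_x (F n x ^+ 2) @[n --> \oo] --> (0 : R) -> bounded_mfun g ->
  'E (fun x => g x * F n x) @[n --> \oo] --> (0 : R).
Proof.
move=> PQ mF FM F0 bg; have bF n : bounded_mfun (F n) by split; last exists M.
have [_ [K gK]] := bg.
have KF0 : K * 'E (fun x => `|F n x|) @[n --> \oo] --> (0 : R).
  rewrite -[X in _ --> X](mulr0 K); apply: cvgMl_tmp.
  exact: dominated_expect_norm_cvg0 PQ mF FM F0.
apply/norm_cvg0P; apply: squeeze_cvgr (cvg_cst 0) KF0; apply: nearW => n.
have bgF := bounded_mfunM bg (bF n); have bnF := bounded_mfun_norm (bF n).
rewrite normr_ge0 -expectZ// (le_trans (norm_expect_le P bgF))//.
apply: le_expect (bounded_mfun_norm bgF) (bounded_mfunZ K bnF) _ => x.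
by rewrite normrM ler_wpM2r.
Qed.

End mean_square.

Section centered_indicator.
Context {d : measure_display} {Omega : measurableType d} {R : realType}.
Variable P : probability Omega R.
Implicit Types A B : set Omega.

Definition centered_indic A x : R := \1_A x - fine (P A).

Lemma norm_centered_indic_le1 A x : measurable A -> `|centered_indic A x| <= 1.
Proof.
move=> mA; rewrite /centered_indic indicE ler_norml.
have := fine_prob_ge0 P A; have := fine_prob_le1 P mA.
by case: (x \in A) => /= *; apply/andP; split; lra.
Qed.

Lemma bounded_mfun_centered_indic A : measurable A -> bounded_mfun (centered_indic A).
Proof.
by move=> mA; apply: bounded_mfunB; [exact: bounded_mfun_indic|exact: bounded_mfun_cst].
Qed.

Lemma expect_centered_indic A : measurable A -> \int[P]_x centered_indic A x = 0.
Proof.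
move=> mA; rewrite expectB; [|exact: bounded_mfun_indic|exact: bounded_mfun_cst].
by rewrite expect_indic// expect_cst subrr.
Qed.

Lemma expect_indic_subr_cst A B (c : R) : measurable A -> measurable B ->
  \int[P]_x (\1_A x * (\1_B x - c)) = fine (P (A `&` B)) - fine (P A) * c.
Proof.
move=> mA mB; have mAB : measurable (A `&` B) by exact: measurableI.
transitivity (\int[P]_x (\1_(A `&` B) x - c * \1_A x)).
  by apply: eq_Rintegral => x _; rewrite indicI/=; ring.
rewrite expectB; [|exact: bounded_mfun_indic|exact/bounded_mfunZ/bounded_mfun_indic].
by rewrite expectZ ?expect_indic// 1?mulrC//; exact: bounded_mfun_indic.
Qed.

Lemma expect_centered_indicM A B : measurable A -> measurable B ->
  \int[P]_x (centered_indic A x * centered_indic B x) =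
  fine (P (A `&` B)) - fine (P A) * fine (P B).
Proof.
move=> mA mB; rewrite -expect_indic_subr_cst//.
transitivity (\int[P]_x
    (\1_A x * (\1_B x - fine (P B)) - fine (P A) * centered_indic B x)).
  by apply: eq_Rintegral => x _; rewrite /centered_indic; ring.
rewrite expectB ?expectZ ?expect_centered_indic ?mulr0 ?subr0//.
- exact: bounded_mfun_centered_indic.
- by apply: bounded_mfunM; [exact: bounded_mfun_indic|exact: bounded_mfun_centered_indic].
- exact/bounded_mfunZ/bounded_mfun_centered_indic.
Qed.

End centered_indicator.

(** * Upper probabilities and their cores *)

Section capacities.
Context {d : measure_display} {Omega : measurableType d} {R : realType}.
Implicit Types (mu V P : set Omega -> R) (Q : probability Omega R) (A B N : set Omega).

Lemma capacity_ge0 mu A : capacity mu -> measurable A -> 0 <= mu A.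
Proof. by move=> [_ [_ [mu01 _]]] /mu01 /andP[]. Qed.

Lemma le_capacity mu A B : capacity mu -> measurable A -> measurable B ->
  A `<=` B -> mu A <= mu B.
Proof. by move=> [_ [_ [_ mu_mono]]]; exact: mu_mono. Qed.

Lemma capacity_sub_null mu A B : capacity mu -> measurable A -> measurable B ->
  A `<=` B -> mu B = 0 -> mu A = 0.
Proof.
move=> cmu mA mB AB B0; apply/eqP.
by rewrite eq_le capacity_ge0// andbT -B0 le_capacity.
Qed.

Lemma core_le V P A : core V P -> measurable A -> P A <= V A.
Proof. by move=> [_ [_ [_ [_ +]]]]; exact. Qed.

Lemma fine_prob_core V Q : (forall A, measurable A -> fine (Q A) <= V A) ->
  core V (fun A => fine (Q A)).
Proof.
move=> QV; split; first by rewrite measure0.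
split; first by rewrite probability_setT.
split=> [A mA|]; first exact: fine_prob_ge0.
by split=> // A B mA mB AB; exact: fine_probU.
Qed.

Lemma core_null V Q N : core V (fun A => fine (Q A)) -> measurable N ->
  V N = 0 -> Q N = 0%E.
Proof. by move=> cQ mN N0; apply: fine_prob_le0 => //; rewrite -N0 (core_le cQ). Qed.

Lemma upper_probability_attained V A : upper_probability V -> measurable A ->
  exists2 Q : probability Omega R, core V (fun B => fine (Q B)) & fine (Q A) = V A.
Proof.
move=> [_ [Lambda [_ LV]]] mA; have [_ [Q LQ QA]] := LV _ mA.
exists Q; last by rewrite QA.
apply: fine_prob_core => B mB; rewrite -lee_fin fine_probK//.
by have [+ _] := LV _ mB; exact.
Qed.

Lemma upper_probability_bigcap_ge V (F : nat -> set Omega) (v : R) :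
  upper_probability V -> (forall n, measurable (F n)) -> nonincreasing_seq F ->
  (forall n, v <= V (F n)) -> v <= V (\bigcap_n F n).
Proof.
move=> [_ [Lambda [cL LV]]] mF niF vF.
have /choice[p pP] n : exists Q, Lambda Q /\ Q (F n) = (V (F n))%:E.
  by have [_ [Q LQ QF]] := LV _ (mF n); exists Q.
have [G [GU sG]] := ultraFilterLemma
  (fmap_proper_filter (setwise_eval \o p) (@eventually_filter)).
have GL : G (setwise_eval @` Lambda).
  by apply: sG; exists 0%N => // n _; exists (p n) => //; case: (pP n).
move: cL; rewrite /setwise_compact compact_ultra => /(_ G GU GL)[_ [[Q LQ <-] /= GQ]].
have mI : measurable (\bigcap_n F n) by exact: bigcap_measurable.
have [+ _] := LV _ mI; move=> /(_ Q LQ); rewrite -fine_probK// lee_fin.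
apply: le_trans; apply: prob_bigcap_nonincreasing_ge => // m.
have evalG : (fun g : {ptws set Omega -> R} => g (F m)) @ G --> setwise_eval Q (F m).
  exact: (@cvg_comp _ _ _ id (fun g : {ptws set Omega -> R} => g (F m)) _ _ _ GQ
    (@proj_continuous _ (fun=> R) (F m) (setwise_eval Q))).
have -> : fine (Q (F m)) = setwise_eval Q (F m) by rewrite /setwise_eval asboolT.
apply: (closed_cvg (fun x => v <= x)) evalG; first exact: closed_ge.
apply: sG; exists m => // n /= mn; rewrite /setwise_eval asboolT//.
have [_ pFn] := pP n; apply: (le_trans (vF n)).
by rewrite -lee_fin -pFn fine_probK// le_measure ?inE//; exact/subsetPset/niF.
Qed.

Lemma upper_probability_cvg0 V (F : nat -> set Omega) (e : R) :
  upper_probability V -> (forall n, measurable (F n)) -> nonincreasing_seq F ->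
  \bigcap_n F n = set0 -> 0 < e -> exists n, V (F n) < e.
Proof.
move=> uV mF niF F0 e0; apply: contrapT => /forallNP Fe.
have : e <= V (\bigcap_n F n).
  by apply: upper_probability_bigcap_ge => // n; rewrite leNgt; exact/negP.
by rewrite F0; case: uV => -[-> _] _; rewrite leNgt e0.
Qed.

Lemma bigcup_tail_nonincreasing (F : nat -> set Omega) :
  nonincreasing_seq (fun n => \bigcup_(k >= n) F k).
Proof.
move=> m n mn; apply/subsetPset => x [k /= nk Fkx].
by exists k => //=; exact: leq_trans nk.
Qed.

Lemma core_bigcup_tail V P (F : nat -> set Omega) n : core V P ->
  (forall k, measurable (F k)) -> trivIset setT F ->
  P (\bigcup_k F k) = \sum_(0 <= i < n) P (F i) + P (\bigcup_(k >= n) F k).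
Proof.
move=> [_ [_ [_ [PU _]]]] mF tF; elim: n => [|n ->].
  by rewrite big_geq// add0r; congr P; exact: eq_bigcupl.
rewrite big_nat_recr//= -addrA; congr (_ + _).
rewrite -PU//; last 2 first.
- by apply: bigcup_measurable => k _; exact: mF.
- rewrite -subset0 => x [Fnx [k /= nk Fkx]].
  have /(tF n k I I) kn : F n `&` F k !=set0 by exists x.
  by rewrite kn ltnn in nk.
congr P; apply/seteqP; split => x.
  move=> [k /= nk Fkx]; move: nk; rewrite leq_eqVlt => /predU1P[->|nk]; first by left.
  by right; exists k.
by move=> [Fx|[k /= nk Fkx]]; [exists n => /=|exists k => //=; exact: ltnW].
Qed.

Section core_measure.
Variables (V P : set Omega -> R) (uV : upper_probability V) (cP : core V P).

Definition core_measure A : \bar R := if `[< measurable A >] then (P A)%:E else 0%E.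

Lemma core_measureE A : measurable A -> core_measure A = (P A)%:E.
Proof. by move=> mA; rewrite /core_measure asboolT. Qed.

Let core_measure0 : core_measure set0 = 0%E.
Proof. by rewrite core_measureE//; case: cP => ->. Qed.

Let core_measure_ge0 A : (0 <= core_measure A)%E.
Proof.
rewrite /core_measure; case: asboolP => // mA; rewrite lee_fin.
by case: cP => _ [_ [+ _]]; exact.
Qed.

(* Countable additivity comes from the continuity of [V] at the empty set,
   which dominates [P] on the tails of a disjoint union. *)
Let core_measure_sigma_additive : semi_sigma_additive core_measure.
Proof.
move=> F mF tF mU; pose W n := \bigcup_(k >= n) F k.
have mW n : measurable (W n) by apply: bigcup_measurable => k _; exact: mF.
rewrite core_measureE//.
rewrite (_ : (fun n => _) = EFin \o (fun n => \sum_(0 <= i < n) P (F i))); last first.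
  by apply/funext => n /=; rewrite -sumEFin; apply: eq_bigr => i _; exact: core_measureE.
apply: cvg_EFin; first exact: nearW.
apply/cvgrPdist_le => e e0.
have [m Wm] : exists n, V (W n) < e.
  apply: upper_probability_cvg0 => //; first exact: bigcup_tail_nonincreasing.
  rewrite -subset0 => x Wx; have [k _ Fkx] := Wx 0%N I.
  have [j /= kj Fjx] := Wx k.+1 I.
  have /(tF k j I I) jk : F k `&` F j !=set0 by exists x.
  by rewrite jk ltnn in kj.
exists m => // n /= mn; rewrite (core_bigcup_tail n cP mF tF) addrC addKr.
have P0 : 0 <= P (W n) by case: cP => _ [_ [+ _]]; exact.
rewrite ger0_norm// (le_trans (core_le cP (mW n)))// (le_trans _ (ltW Wm))//.
by apply: le_capacity; [case: uV|exact: mW|exact: mW|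
  exact/subsetPset/bigcup_tail_nonincreasing].
Qed.

HB.instance Definition _ := isMeasure.Build _ _ _ core_measure
  core_measure0 core_measure_ge0 core_measure_sigma_additive.

Let core_measure_setT : core_measure setT = 1%E.
Proof. by rewrite core_measureE//; case: cP => _ [-> _]. Qed.

HB.instance Definition _ :=
  Measure_isProbability.Build _ _ _ core_measure core_measure_setT.

Lemma core_probability :
  exists Q : probability Omega R, forall A, measurable A -> fine (Q A) = P A.
Proof. by exists core_measure => A mA /=; rewrite core_measureE. Qed.

End core_measure.
End capacities.

Section iterates.
Context {d : measure_display} {Omega : measurableType d} {R : realType}.
Variable T : Omega -> Omega.
Hypothesis mT : measurable_fun setT T.
Implicit Types (V : set Omega -> R) (P Q : probability Omega R) (A N : set Omega).

Lemma measurable_iter k : measurable_fun setT (iter k T).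
Proof.
elim: k => [|k ih]; first exact: measurable_id.
exact: (measurableT_comp mT ih).
Qed.

Lemma measurable_preimage_iter k A : measurable A -> measurable (iter k T @^-1` A).
Proof. by move=> mA; rewrite -[X in measurable X]setTI; exact: measurable_iter. Qed.

Lemma preimage_iterS k A : iter k.+1 T @^-1` A = T @^-1` (iter k T @^-1` A).
Proof. by apply/seteqP; split => x; rewrite /preimage/= -iterS iterSr. Qed.

Lemma preimage_iter_invariant k A : T @^-1` A = A -> iter k T @^-1` A = A.
Proof. by move=> TA; elim: k => // k ih; rewrite preimage_iterS ih. Qed.

Lemma cap_invariant_iter k V : cap_invariant T V -> cap_invariant (iter k T) V.
Proof.
move=> iV A mA; elim: k => [//|k ih].
by rewrite preimage_iterS iV ?ih//; exact: measurable_preimage_iter.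
Qed.

Lemma invariant_prob_iter k P : invariant_prob T P -> invariant_prob (iter k T) P.
Proof.
move=> iP A mA; elim: k => [//|k ih].
by rewrite preimage_iterS iP ?ih//; exact: measurable_preimage_iter.
Qed.

Lemma bounded_mfun_iter k (f : Omega -> R) : bounded_mfun f ->
  bounded_mfun (fun x => f (iter k T x)).
Proof. exact/bounded_mfun_comp/measurable_iter. Qed.

Definition orbit_limit P A : R := banach_limit (fun i => fine (P (iter i T @^-1` A))).

Let norm_orbit_le1 P A : measurable A -> forall i, `|fine (P (iter i T @^-1` A))| <= 1.
Proof. by move=> mA i; apply: norm_fine_prob_le1; exact: measurable_preimage_iter. Qed.

Lemma orbit_limit_core V P : cap_invariant T V -> core V (fun A => fine (P A)) ->
  core V (orbit_limit P).
Proof.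
move=> iV cP; split.
  rewrite -[RHS]banach_limit_cst; congr banach_limit; apply/funext => i.
  by rewrite preimage_set0 measure0.
split.
  rewrite -[RHS]banach_limit_cst; congr banach_limit; apply/funext => i.
  by rewrite preimage_setT probability_setT.
split=> [A mA|].
  rewrite -[leLHS]banach_limit_cst; apply: (@le_banach_limit _ _ _ 0 1) => i.
  - by rewrite normr0.
  - exact: norm_orbit_le1.
  - exact: fine_prob_ge0.
split=> [A B mA mB AB|A mA].
  rewrite -(@banach_limitD _ _ _ 1 1); [|exact: norm_orbit_le1..].
  congr banach_limit; apply/funext => i; rewrite preimage_setU fine_probU//.
  - exact: measurable_preimage_iter.
  - exact: measurable_preimage_iter.
  - by rewrite -preimage_setI AB preimage_set0.
rewrite -[leRHS]banach_limit_cst; apply: (@le_banach_limit _ _ _ 1 `|V A|) => // i.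
  exact: norm_orbit_le1.
rewrite -(cap_invariant_iter i iV mA) (core_le cP)//; exact: measurable_preimage_iter.
Qed.

Lemma core_invariant_probability V : upper_probability V -> cap_invariant T V ->
  exists2 Q : probability Omega R, core V (fun A => fine (Q A)) & invariant_prob T Q.
Proof.
move=> uV iV; have [P cP _] := upper_probability_attained uV measurableT.
have cq := orbit_limit_core iV cP; have [Q Qq] := core_probability uV cq.
exists Q; first by apply: fine_prob_core => A mA; rewrite Qq// (core_le cq).
move=> A mA; have mTA : measurable (T @^-1` A) by exact: (measurable_preimage_iter 1).
rewrite -fine_probK// -[RHS]fine_probK// !Qq//; congr (_%:E).
by rewrite [RHS]/orbit_limit -(banach_limitS (norm_orbit_le1 P mA)).
Qed.

Definition visits_after N n := \bigcup_(k >= n) (iter k T @^-1` N).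

Definition recurrent_set N := \bigcap_n visits_after N n.

Lemma measurable_visits_after N n : measurable N -> measurable (visits_after N n).
Proof.
by move=> mN; apply: bigcup_measurable => k _; exact: measurable_preimage_iter.
Qed.

Lemma measurable_recurrent_set N : measurable N -> measurable (recurrent_set N).
Proof.
by move=> mN; apply: bigcap_measurable => // n _; exact: measurable_visits_after.
Qed.

Lemma preimage_visits_after N n : T @^-1` (visits_after N n) = visits_after N n.+1.
Proof.
apply/seteqP; split => x.
  by move=> [k /= nk]; rewrite /preimage/= -iterSr => Nx; exists k.+1.
by move=> [[//|k] /= nk Nx]; exists k => //; rewrite /preimage/= -iterSr.
Qed.

Lemma recurrent_set_invariant N : T @^-1` (recurrent_set N) = recurrent_set N.
Proof.
rewrite /recurrent_set preimage_bigcap.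
under eq_bigcapr do rewrite preimage_visits_after.
apply/seteqP; split => x Nx n _; last exact: Nx n.+1 I.
by have /subsetPset := bigcup_tail_nonincreasing (fun k => iter k T @^-1` N) (leqnSn n);
  apply; exact: Nx n I.
Qed.

Lemma le_upper_probability_recurrent_set V N : upper_probability V ->
  cap_invariant T V -> measurable N -> V N <= V (recurrent_set N).
Proof.
move=> uV iV mN; apply: upper_probability_bigcap_ge => // [n||n].
- exact: measurable_visits_after.
- exact: bigcup_tail_nonincreasing.
have -> : V (visits_after N n) = V (visits_after N 0).
  elim: n => // n <-; rewrite -preimage_visits_after iV//.
  exact: measurable_visits_after.
apply: le_capacity => //; [by case: uV|exact: measurable_visits_after|].
by move=> x Nx; exists 0%N.
Qed.

Lemma ae_iter Q (p : Omega -> Prop) : invariant_prob T Q -> {ae Q, forall x, p x} ->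
  {ae Q, forall x, forall k, p (iter k T x)}.
Proof.
move=> iQ [N [mN QN pN]]; apply: ae_foralln => k; exists (iter k T @^-1` N); split.
- exact: measurable_preimage_iter.
- by rewrite [LHS](invariant_prob_iter k iQ mN).
- by move=> x /= npx; exact: pN.
Qed.

End iterates.

Section null_sets.
Context {d : measure_display} {Omega : measurableType d} {R : realType}.
Implicit Types (mu nu V : set Omega -> R) (Q : probability Omega R) (T : Omega -> Omega).

Definition same_null_sets mu nu :=
  forall N, measurable N -> mu N = 0 <-> nu N = 0.

Lemma cap_weakly_mixing_same_null_sets T mu nu : same_null_sets mu nu ->
  cap_weakly_mixing T mu -> cap_weakly_mixing T nu.
Proof.
move=> munu wmu f lam mf [N [mN [N0 fT]]].
have [|c [M [mM [M0 fc]]]] := wmu f lam mf; first by exists N; rewrite munu.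
by exists c, M; rewrite -munu.
Qed.

Lemma cap_as_fine_prob Q (p : Omega -> Prop) :
  cap_as (fun A => fine (Q A)) p <-> {ae Q, forall x, p x}.
Proof.
split=> [[N [mN [/fine_prob_eq0 QN pN]]]|[N [mN QN pN]]]; exists N.
  by split => //; [exact: QN|move=> x /=; apply: contra_notP => /pN].
split => //; split; first by rewrite QN.
by move=> x; apply: contra_notP => /pN.
Qed.

Lemma upper_probability_same_null_sets T V Q : measurable_fun setT T ->
  upper_probability V -> cap_invariant T V -> core V (fun A => fine (Q A)) ->
  invariant_prob T Q ->
  (forall A, measurable A -> T @^-1` A = A -> Q A = 0%E -> V A = 0) ->
  same_null_sets V (fun A => fine (Q A)).
Proof.
move=> mT uV iV cQ iQ QV N mN; rewrite fine_prob_eq0//.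
split=> [|QN]; first exact: core_null.
apply/eqP; rewrite eq_le (capacity_ge0 _ mN) ?andbT; last by case: uV.
rewrite (le_trans (le_upper_probability_recurrent_set mT uV iV mN))//.
rewrite QV//; [exact: measurable_recurrent_set|exact: recurrent_set_invariant|].
apply/negligibleP; first exact: measurable_recurrent_set.
have nN : {ae Q, forall x, ~ N x} by exists N; split => // x /= /contrapT.
apply: negligibleS (ae_iter mT iQ nN) => x /(_ 0%N I)[k _ Nx] /=.
by move=> /(_ k).
Qed.

End null_sets.

(** * Decay of correlations *)

Section trigonometric_sums.
Context {R : realType}.
Implicit Types (k l n M : nat) (a t : R).

Definition circle_point M l : R := 2 * pi * l%:R / M%:R.

Lemma sum_cos_arithmetic a n :
  2 * sin a * \sum_(l < n) cos (a * (2 * l%:R)) = sin a + sin (a * (2 * n%:R - 1)).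
Proof.
elim: n => [|n ih]; first by rewrite big_ord0 !mulr0 sub0r mulrN1 sinN subrr.
rewrite big_ord_recr/= mulrDr ih -addrA; congr (_ + _).
have -> : a * (2 * n%:R - 1) = a * (2 * n%:R) - a by ring.
have -> : a * (2 * n.+1%:R - 1) = a * (2 * n%:R) + a by rewrite -natr1; ring.
by rewrite sinB sinD; ring.
Qed.

Lemma sum_cos_circle k M : (0 < k < M)%N ->
  \sum_(l < M) cos (k%:R * circle_point M l) = 0.
Proof.
move=> /andP[k0 kM]; have M0 : (0 < M)%N by exact: ltn_trans kM.
set a : R := k%:R * pi / M%:R.
have sin_a : sin a != 0.
  rewrite gt_eqF//; apply: sin_gt0_pi; rewrite divr_gt0 ?mulr_gt0 ?pi_gt0 ?ltr0n//=.
  by rewrite ltr_pdivrMr ?ltr0n// mulrC ltr_pM2l ?pi_gt0 ?ltr_nat.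
apply: (mulfI (mulf_neq0 (_ : 2 != 0) sin_a)); first by rewrite pnatr_eq0.
under eq_bigr => l _.
  rewrite (_ : _ * _ = a * (2 * l%:R)); last by rewrite /a /circle_point; ring.
  over.
rewrite sum_cos_arithmetic mulr0.
have -> : a * (2 * M%:R - 1) = - a + (pi *+ 2) *+ k.
  by rewrite /a -mulr_natr -mulr_natr; field; rewrite pnatr_eq0 -lt0n.
by rewrite (periodicn (@sinD2pi R)) sinN subrr.
Qed.

Lemma sum_cosB_circle i j M : (i < M)%N -> (j < M)%N ->
  \sum_(l < M) cos ((i%:R - j%:R) * circle_point M l) = M%:R * (i == j)%:R.
Proof.
wlog ij : i j / (j <= i)%N => [sym iM jM|iM jM].
  have /orP[ij|ij] := leq_total j i; first exact: sym.
  rewrite eq_sym -sym//; apply: eq_bigr => l _.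
  by rewrite -[in RHS]cosN -mulNr opprB.
have [->|nij] := eqVneq i j.
  under eq_bigr do rewrite subrr mul0r cos0.
  by rewrite sumr_const card_ord mulr1.
rewrite mulr0 -natrB// sum_cos_circle// subn_gt0 ltn_neqAle eq_sym nij ij/=.
exact: leq_ltn_trans (leq_subr _ _) iM.
Qed.

End trigonometric_sums.

Section toeplitz.
Context {R : realType}.
Variable b : nat -> nat -> R.
Hypothesis b_shift : forall i j k, b (i + k) (j + k) = b i j.
Hypothesis b_sym : forall i j, b i j = b j i.
Implicit Types (n M N : nat) (t : R).

Definition toeplitz_form n t : R :=
  \sum_(p : 'I_n * 'I_n) b p.1 p.2 * cos ((p.1%:R - p.2%:R) * t).

Definition same_diagonal n (p q : 'I_n * 'I_n) := (p.1 + q.2 == p.2 + q.1)%N.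

Definition transpose_index n (p : 'I_n * 'I_n) := (p.2, p.1).

Lemma toeplitz_same_diagonal n (p q : 'I_n * 'I_n) :
  same_diagonal p q -> b p.1 p.2 = b q.1 q.2.
Proof.
by move=> /eqP pq; rewrite -(b_shift p.1 _ q.2) pq addnC [X in b _ X]addnC b_shift.
Qed.

Lemma sum_toeplitz_form_circle n M : (n <= M)%N ->
  \sum_(l < M) toeplitz_form n (circle_point M l) = M%:R * n%:R * b 0 0.
Proof.
move=> nM; rewrite exchange_big -(pair_bigA _ (fun i j : 'I_n => \sum_(l < M)
  b i j * cos ((i%:R - j%:R) * circle_point M l)))/=.
rewrite (eq_bigr (fun=> M%:R * b 0 0)) => [|i _].
  by rewrite sumr_const card_ord -[_ *+ n]mulr_natl; ring.
rewrite (eq_bigr (fun j : 'I_n => b i j * (M%:R * (i == j :> nat)%:R))) => [|j _].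
  rewrite (bigD1 i)//= eqxx mulr1 -(b_shift 0 0 i) mulrC big1 ?addr0// => j ji.
  by rewrite (_ : (i == j :> nat) = false) ?mulr0//; apply/negbTE; rewrite eq_sym.
by rewrite -mulr_sumr sum_cosB_circle// (leq_trans _ nM).
Qed.

Lemma sum_cosM_circle n (p q : 'I_n * 'I_n) :
  \sum_(l < 2 * n) cos ((p.1%:R - p.2%:R) * circle_point (2 * n) l) *
                   cos ((q.1%:R - q.2%:R) * circle_point (2 * n) l) =
  n%:R * ((same_diagonal p q)%:R + (same_diagonal p (transpose_index q))%:R) :> R.
Proof.
have ltD2n (i j : 'I_n) : (i + j < 2 * n)%N
  by rewrite mul2n -addnn -addSn leq_add// ltnW.
rewrite (eq_bigr (fun l : 'I_(2 * n) => 2^-1 *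
  (cos (((p.1 + q.2)%:R - (p.2 + q.1)%:R) * circle_point (2 * n) l) +
   cos (((p.1 + q.1)%:R - (p.2 + q.2)%:R) * circle_point (2 * n) l)))).
  rewrite -mulr_sumr big_split/= !sum_cosB_circle// /same_diagonal/= natrM.
  by field.
move=> l _; set t := circle_point _ _.
set x := (p.1%:R - p.2%:R) * t; set y := (q.1%:R - q.2%:R) * t.
rewrite (_ : _ * t = x - y); last by rewrite /x /y !natrD; ring.
rewrite (_ : (_ - (p.2 + q.2)%:R) * t = x + y); last by rewrite /x /y !natrD; ring.
by rewrite cosB cosD; field.
Qed.

(* Parseval on the circle of [2n] equidistant points. *)
Lemma sum_toeplitz_form_sqr_ge n :
  n%:R * \sum_(p : 'I_n * 'I_n)
    b p.1 p.2 ^+ 2 * #|same_diagonal p|%:R <=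
  \sum_(l < 2 * n) toeplitz_form n (circle_point (2 * n) l) ^+ 2.
Proof.
under [leRHS]eq_bigr do rewrite expr2 big_distrlr/=.
rewrite [leRHS]exchange_big mulr_sumr; apply: ler_sum => p _.
rewrite [leRHS]exchange_big -sum1_card natr_sum big_mkcond/= !mulr_sumr.
apply: ler_sum => q _; rewrite -[q \in _]/(same_diagonal p q).
under eq_bigr do rewrite mulrACA.
rewrite -mulr_sumr sum_cosM_circle [leRHS]mulrCA ler_wpM2l//.
have [pq|_] := boolP (same_diagonal p q); last rewrite mulr0 add0r.
  by rewrite (toeplitz_same_diagonal pq) expr2 ler_wpM2l ?lerDl// -expr2 sqr_ge0.
have [pq|_] := boolP (same_diagonal p (transpose_index q)); last by rewrite mulr0.
by rewrite (toeplitz_same_diagonal pq) b_sym mulr1 -expr2 sqr_ge0.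
Qed.

Lemma card_same_diagonal_ge N (p : 'I_(2 * N) * 'I_(2 * N)) :
  (p.1 < N)%N -> (p.2 < N)%N -> (N <= #|same_diagonal p|)%N.
Proof.
move=> p1N p2N; have ltD (i : 'I_(2 * N)) (k : 'I_N) : (i < N)%N -> (i + k < 2 * N)%N.
  by move=> iN; rewrite [ltnRHS]mul2n -addnn -addSn leq_add// ltnW.
pose shift k := (Ordinal (ltD p.1 k p1N), Ordinal (ltD p.2 k p2N)).
have shift_inj : injective shift.
  by move=> k k' [/addnI kk' _]; exact: val_inj.
rewrite -{1}[N]card_ord -(card_codom shift_inj) subset_leq_card//.
by apply/fintype.subsetP => _ /codomP[k ->]; rewrite unfold_in /same_diagonal/= addnCA.
Qed.

Lemma toeplitz_sum_sqr_le N (s : R) : (0 < N)%N ->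
  (forall t, 0 <= toeplitz_form (2 * N) t) ->
  (forall t, 0 <= t <= 2 * pi -> toeplitz_form (2 * N) t <= s) ->
  \sum_(i < N) \sum_(j < N) b i j ^+ 2 <= 4 * b 0 0 * s.
Proof.
move=> N0 form_ge0 form_le; set n := (2 * N)%N; have n0 : (0 < n)%N by rewrite muln_gt0.
have n0R : 0 < n%:R :> R by rewrite ltr0n.
have upper : \sum_(l < 2 * n) toeplitz_form n (circle_point (2 * n) l) ^+ 2 <=
    (2 * n)%:R * n%:R * b 0 0 * s.
  rewrite -sum_toeplitz_form_circle ?leq_pmull// mulr_suml; apply: ler_sum => l _.
  rewrite expr2 ler_wpM2l// form_le// /circle_point.
  rewrite divr_ge0 ?mulr_ge0 ?pi_ge0//= ler_pdivrMr ?ltr0n ?muln_gt0//.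
  by rewrite ler_pM2l ?mulr_gt0 ?pi_gt0// ler_nat ltnW.
have lower : N%:R * \sum_(i < N) \sum_(j < N) b i j ^+ 2 <=
    \sum_(p : 'I_n * 'I_n) b p.1 p.2 ^+ 2 * #|same_diagonal p|%:R.
  have Nn : (N <= n)%N by rewrite leq_pmull.
  rewrite (big_ord_widen n (fun i => \sum_(j < N) b i j ^+ 2) Nn).
  under eq_bigr => i _ do rewrite (big_ord_widen n (fun j => b i j ^+ 2) Nn).
  rewrite pair_big/= mulr_sumr big_mkcond; apply: ler_sum => p _.
  case: ifPn => [/andP[p1N p2N]|_]; last by rewrite mulr_ge0 ?sqr_ge0.
  by rewrite mulrC ler_wpM2l ?sqr_ge0// ler_nat card_same_diagonal_ge.
have nN0 : 0 < n%:R * N%:R :> R by rewrite mulr_gt0 ?ltr0n.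
rewrite -(ler_pM2l nN0) -[leLHS]mulrA.
apply: le_trans (ler_wpM2l (ltW n0R) lower) _.
apply: le_trans (sum_toeplitz_form_sqr_ge n) _.
apply: le_trans upper _.
by rewrite [leLHS](_ : _ = n%:R * N%:R * (4 * b 0 0 * s))// /n !natrM; ring.
Qed.

End toeplitz.

Section coef_dot.
Context {R : realType}.
Implicit Types (u v : nat -> R) (p q : {poly R}) (n : nat).

Definition coef_dot u p := \sum_(i < size p) p`_i * u i.

Lemma coef_dot_widen u p n : (size p <= n)%N ->
  coef_dot u p = \sum_(i < n) p`_i * u i.
Proof.
move=> pn; rewrite /coef_dot (big_ord_widen n (fun i => p`_i * u i) pn) big_mkcond.
by apply: eq_bigr => i _; case: ltnP => // ip; rewrite nth_default// mul0r.
Qed.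

Lemma coef_dotD u p q : coef_dot u (p + q) = coef_dot u p + coef_dot u q.
Proof.
pose n := maxn (size p) (size q).
rewrite !(@coef_dot_widen _ _ n) ?leq_maxl ?leq_maxr ?size_polyD// -big_split/=.
by apply: eq_bigr => i _; rewrite coefD mulrDl.
Qed.

Lemma coef_dotZ u c p : coef_dot u (c *: p) = c * coef_dot u p.
Proof.
rewrite !(@coef_dot_widen _ _ (size p)) ?size_scale_leq// mulr_sumr.
by apply: eq_bigr => i _; rewrite coefZ mulrA.
Qed.

Lemma coef_dotB u p q : coef_dot u (p - q) = coef_dot u p - coef_dot u q.
Proof. by rewrite coef_dotD -[- q]scaleN1r coef_dotZ mulN1r. Qed.

Lemma coef_dotXM u p : coef_dot u ('X * p) = coef_dot (fun i => u i.+1) p.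
Proof.
rewrite (@coef_dot_widen _ _ (size p).+1).
  rewrite big_ord_recl coefXM/= mul0r add0r; apply: eq_bigr => i _.
  by rewrite coefXM.
by rewrite (leq_trans (size_polyMleq _ _))// size_polyX.
Qed.

Lemma coef_dot_linear a c u v p :
  coef_dot (fun i => a * u i + c * v i) p = a * coef_dot u p + c * coef_dot v p.
Proof.
by rewrite /coef_dot !mulr_sumr -big_split/=; apply: eq_bigr => i _; ring.
Qed.

Definition cesaro_poly n : {poly R} := \poly_(i < n) n%:R^-1.

Lemma cesaro_polyE n : cesaro_poly n = n%:R^-1 *: \sum_(i < n) 'X^i.
Proof. by rewrite /cesaro_poly poly_def scaler_sumr. Qed.

Lemma subX1M_cesaro_poly n : ('X - 1) * cesaro_poly n = n%:R^-1 *: ('X^n - 1).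
Proof. by rewrite cesaro_polyE -scalerAr -subrX1. Qed.

Lemma horner1_cesaro_poly n : (0 < n)%N -> (cesaro_poly n).[1] = 1.
Proof.
move=> n0; rewrite cesaro_polyE hornerZ horner_sum.
by under eq_bigr do rewrite hornerXn expr1n; exact: cesaro_mean_cst.
Qed.

Lemma coef_dot_cesaro_polyM u p n : coef_dot u (cesaro_poly n * p) =
  cesaro_mean (fun i => coef_dot u ('X^i * p)) n.
Proof.
rewrite cesaro_polyE -scalerAl coef_dotZ mulr_suml; congr (_ * _).
elim/big_rec2: _ => [|i x y _ <-]; last by rewrite coef_dotD.
by rewrite -(scale0r 0) coef_dotZ mul0r.
Qed.

Lemma coef_dot_cesaro_poly u n : coef_dot u (cesaro_poly n) = cesaro_mean u n.
Proof.
rewrite (@coef_dot_widen _ _ n) ?size_poly// /cesaro_mean mulr_sumr.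
by apply: eq_bigr => i _; rewrite coef_poly ltn_ord.
Qed.

End coef_dot.

Lemma exists_gt1M_lt (R : realFieldType) (a c : R) : 0 <= a -> a < c ->
  exists2 e, 0 < e & (1 + e) * a < c.
Proof.
move=> a0 ac; have a1 : 0 < a + 1 by rewrite ltr_wpDl.
exists ((c - a) / (a + 1)); first by rewrite divr_gt0// subr_gt0.
have -> : (1 + (c - a) / (a + 1)) * a = c - (c - a) / (a + 1).
  by field; rewrite gt_eqF.
by rewrite ltrBlDr ltrDl divr_gt0// subr_gt0.
Qed.

Section energy.
Context {d : measure_display} {Omega : measurableType d} {R : realType}.
Variables (Q : probability Omega R) (T : Omega -> Omega).
Hypotheses (mT : measurable_fun setT T) (iQ : invariant_prob T Q).
Implicit Types (p r : {poly R}) (s t e c : R) (i j k n : nat).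

Local Notation "''E' g" := (Rintegral Q setT g) (at level 10, g at level 8).

Lemma expect_comp (g : Omega -> R) : bounded_mfun g -> 'E (fun x => g (T x)) = 'E g.
Proof.
move=> bg; rewrite /Rintegral; congr fine.
have bgT := bounded_mfun_comp mT bg.
have := @integral_pushforward _ _ _ _ R T mT Q setT (EFin \o g).
rewrite preimage_setT => <- //.
- by apply: eq_measure_integral => A mA _; exact: iQ.
- by apply/measurable_EFinP; case: bg.
- exact: bounded_mfun_integrable.
Qed.

Lemma expect_iter k (g : Omega -> R) : bounded_mfun g ->
  'E (fun x => g (iter k T x)) = 'E g.
Proof.
move=> bg; elim: k => // k ih; under eq_Rintegral do rewrite iterSr.
by rewrite (@expect_comp (fun x => g (iter k T x)))//; exact: bounded_mfun_iter.
Qed.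

Variable f : Omega -> R.
Hypothesis bf : bounded_mfun f.

Definition autocorrelation i j := 'E (fun x => f (iter i T x) * f (iter j T x)).
Local Notation b := autocorrelation.

Let bounded_iterM i j : bounded_mfun (fun x => f (iter i T x) * f (iter j T x)).
Proof. by apply: bounded_mfunM; exact: bounded_mfun_iter. Qed.

Lemma autocorrelation_shift i j k : b (i + k) (j + k) = b i j.
Proof.
rewrite /b -(@expect_iter k (fun x => f (iter i T x) * f (iter j T x)))//.
by apply: eq_Rintegral => x _; rewrite !iterD.
Qed.

Lemma autocorrelation_sym i j : b i j = b j i.
Proof. by apply: eq_Rintegral => x _; rewrite mulrC. Qed.

Lemma autocorrelation00_ge0 : 0 <= b 0 0.
Proof. by apply: expect_ge0 => x; rewrite -expr2 sqr_ge0. Qed.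

Definition orbit_sum (w : nat -> R) p x := coef_dot (fun i => w i * f (iter i T x)) p.

Lemma bounded_mfun_orbit_sum w p : bounded_mfun (orbit_sum w p).
Proof.
apply: bounded_mfun_sum => i; apply: bounded_mfunZ; apply: bounded_mfunZ.
exact: bounded_mfun_iter.
Qed.

(* Real and imaginary part of [sum_n p_n e^(int) f o T^n]. *)
Definition cos_part t := orbit_sum (fun i => cos (i%:R * t)).
Definition sin_part t := orbit_sum (fun i => sin (i%:R * t)).

Definition energy t p := 'E (fun x => cos_part t p x ^+ 2 + sin_part t p x ^+ 2).

Let bounded_energy t p :
  bounded_mfun (fun x => cos_part t p x ^+ 2 + sin_part t p x ^+ 2).
Proof.
by apply: bounded_mfunD; apply: bounded_mfun_sqr; exact: bounded_mfun_orbit_sum.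
Qed.

Lemma cos_partXM t p x :
  cos_part t ('X * p) x = cos t * cos_part t p (T x) - sin t * sin_part t p (T x).
Proof.
rewrite /cos_part /sin_part /orbit_sum coef_dotXM -mulNr -coef_dot_linear.
congr coef_dot.
by apply/funext => i; rewrite iterSr -natr1 mulrDl mul1r cosD; ring.
Qed.

Lemma sin_partXM t p x :
  sin_part t ('X * p) x = sin t * cos_part t p (T x) + cos t * sin_part t p (T x).
Proof.
rewrite /sin_part /cos_part /orbit_sum coef_dotXM -coef_dot_linear; congr coef_dot.
by apply/funext => i; rewrite iterSr -natr1 mulrDl mul1r sinD; ring.
Qed.

Lemma cos_part_comp t p x :
  cos_part t p (T x) = cos t * cos_part t ('X * p) x + sin t * sin_part t ('X * p) x.
Proof.
by rewrite cos_partXM sin_partXM -[LHS]mul1r -(cos2Dsin2 t); ring.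
Qed.

Lemma sin_part_comp t p x :
  sin_part t p (T x) = cos t * sin_part t ('X * p) x - sin t * cos_part t ('X * p) x.
Proof.
by rewrite cos_partXM sin_partXM -[LHS]mul1r -(cos2Dsin2 t); ring.
Qed.

Lemma energy_parts t p : energy t p =
  'E (fun x => cos_part t p x ^+ 2) + 'E (fun x => sin_part t p x ^+ 2).
Proof. by rewrite /energy expectD//; exact/bounded_mfun_sqr/bounded_mfun_orbit_sum. Qed.

Lemma expect_cos_part_sqr_le t p : 'E (fun x => cos_part t p x ^+ 2) <= energy t p.
Proof. by rewrite energy_parts lerDl expect_ge0// => x; exact: sqr_ge0. Qed.

Lemma expect_sin_part_sqr_le t p : 'E (fun x => sin_part t p x ^+ 2) <= energy t p.
Proof. by rewrite energy_parts lerDr expect_ge0// => x; exact: sqr_ge0. Qed.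

Lemma energy_ge0 t p : 0 <= energy t p.
Proof. by apply: expect_ge0 => x; rewrite addr_ge0 ?sqr_ge0. Qed.

Lemma energyXM t p : energy t ('X * p) = energy t p.
Proof.
rewrite /energy -(expect_comp (bounded_energy t p)); apply: eq_Rintegral => x _.
by rewrite cos_partXM sin_partXM -[RHS]mul1r -(cos2Dsin2 t); ring.
Qed.

Lemma energyXnM t n p : energy t ('X^n * p) = energy t p.
Proof.
elim: n => [|n ih]; first by rewrite expr0 mul1r.
by rewrite exprS -mulrA energyXM ih.
Qed.

Lemma energyZ t c p : energy t (c *: p) = c ^+ 2 * energy t p.
Proof.
rewrite /energy -(expectZ Q _ (bounded_energy t p)); apply: eq_Rintegral => x _.
by rewrite /cos_part /sin_part /orbit_sum !coef_dotZ; ring.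
Qed.

Lemma energyD_le t e p r : 0 < e ->
  energy t (p + r) <= (1 + e) * energy t p + (1 + e^-1) * energy t r.
Proof.
move=> e0; rewrite /energy -!(expectZ Q _ (bounded_energy t _)) -expectD;
  [|exact/bounded_mfunZ/bounded_energy..].
apply: le_expect => [||x]; first exact: bounded_energy.
  by apply: bounded_mfunD; exact/bounded_mfunZ/bounded_energy.
have sqrD_le (y z : R) : (y + z) ^+ 2 <= (1 + e) * y ^+ 2 + (1 + e^-1) * z ^+ 2.
  have -> : (1 + e) * y ^+ 2 + (1 + e^-1) * z ^+ 2 =
      (y + z) ^+ 2 + e^-1 * (e * y - z) ^+ 2 by field; rewrite gt_eqF.
  by rewrite lerDl mulr_ge0 ?sqr_ge0// invr_ge0 ltW.
rewrite /cos_part /sin_part /orbit_sum !coef_dotD.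
set y := coef_dot _ p; set z := coef_dot _ r; set y' := coef_dot _ p.
set z' := coef_dot _ r.
by have := sqrD_le y z; have := sqrD_le y' z'; lra.
Qed.

Lemma energy_parallelogram t p r :
  energy t (p + r) + energy t (p - r) = 2 * energy t p + 2 * energy t r.
Proof.
rewrite /energy -!(expectZ Q _ (bounded_energy t _)) -!expectD;
  try exact: bounded_energy; try exact/bounded_mfunZ/bounded_energy.
apply: eq_Rintegral => x _; rewrite /cos_part /sin_part /orbit_sum !coef_dotB !coef_dotD.
ring.
Qed.

Lemma energy_cesaro_polyM_le t n p : energy t (cesaro_poly n * p) <= energy t p.
Proof.
have [->|n0] := posnP n.
  rewrite cesaro_polyE invr0 scale0r mul0r -(scale0r 0) energyZ expr0n mul0r.
  exact: energy_ge0.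
have bX i : bounded_mfun (fun x =>
    cos_part t ('X^i * p) x ^+ 2 + sin_part t ('X^i * p) x ^+ 2) by exact: bounded_energy.
have -> : energy t p = 'E (fun x => cesaro_mean (fun i =>
    cos_part t ('X^i * p) x ^+ 2 + sin_part t ('X^i * p) x ^+ 2) n).
  rewrite (expect_cesaro_mean _ _ bX) -(cesaro_mean_cst (energy t p) n0).
  by congr cesaro_mean; apply/funext => i; rewrite -[LHS](energyXnM t i).
apply: le_expect => [||x]; first exact: bounded_energy.
  exact: (bounded_mfun_cesaro_mean _ bX).
rewrite cesaro_meanD /cos_part /sin_part /orbit_sum !coef_dot_cesaro_polyM.
by apply: lerD; exact: sqr_cesaro_mean_le.
Qed.

(* Since [p(1) = 1], the polynomial [1 - p] is a multiple of [X - 1], which the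
   Cesaro means kill at rate [1/n]. *)
Lemma energy_cesaro_poly_le p : p.[1] = 1 -> exists r, forall t e n, 0 < e ->
  energy t (cesaro_poly n) <=
  (1 + e) * energy t p + (1 + e^-1) * (4 * energy t r / n%:R ^+ 2).
Proof.
move=> p1; have /factor_theorem[r rE] : root (1 - p) 1.
  by rewrite rootE !hornerE p1 subrr.
exists r => t e n e0.
have -> : cesaro_poly n = cesaro_poly n * p + cesaro_poly n * (1 - p).
  by rewrite -mulrDr addrC subrK mulr1.
apply: le_trans (energyD_le _ _ _ e0) _; apply: lerD.
  by rewrite ler_wpM2l ?energy_cesaro_polyM_le// addr_ge0// ltW.
rewrite ler_wpM2l ?addr_ge0 ?invr_ge0 ?(ltW e0)//.
rewrite rE mulrCA [cesaro_poly n * _]mulrC polyC1 subX1M_cesaro_poly -scalerAr energyZ.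
rewrite exprVn mulrC ler_wpM2r ?invr_ge0 ?exprn_ge0//.
rewrite mulrC mulrBl mul1r -scaleN1r (le_trans (@energyD_le _ 1 _ _ _))//.
by rewrite energyZ energyXnM invr1; lra.
Qed.

Lemma energyE t p n : (size p <= n)%N -> energy t p =
  \sum_(i < n) \sum_(j < n) p`_i * p`_j * (b i j * cos ((i%:R - j%:R) * t)).
Proof.
move=> pn; transitivity ('E (fun x => \sum_(i < n) \sum_(j < n)
    (p`_i * p`_j * cos ((i%:R - j%:R) * t)) * (f (iter i T x) * f (iter j T x)))).
  apply: eq_Rintegral => x _.
  rewrite /cos_part /sin_part /orbit_sum !(coef_dot_widen _ pn) !expr2.
  rewrite !mulr_suml -big_split/=; apply: eq_bigr => i _.
  rewrite !mulr_sumr -big_split/=; apply: eq_bigr => j _.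
  by rewrite [(i%:R - j%:R) * t]mulrBl cosB; ring.
rewrite expect_sum => [|i]; last by apply: bounded_mfun_sum => j; exact: bounded_mfunZ.
apply: eq_bigr => i _; rewrite expect_sum => [|j]; last exact: bounded_mfunZ.
by apply: eq_bigr => j _; rewrite expectZ// /b; ring.
Qed.

Lemma energy_cesaro_poly t n :
  energy t (cesaro_poly n) = n%:R ^- 2 * toeplitz_form b n t.
Proof.
rewrite (@energyE _ _ n) ?size_poly// /toeplitz_form mulr_sumr.
rewrite -(pair_bigA _ (fun i j : 'I_n =>
  n%:R ^- 2 * (b i j * cos ((i%:R - j%:R) * t))))/=.
apply: eq_bigr => i _; apply: eq_bigr => j _.
by rewrite !coef_poly !ltn_ord -expr2 exprVn.
Qed.

Lemma continuous_energy p : continuous (energy ^~ p).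
Proof.
have -> : energy ^~ p = (fun t => \sum_(i < size p) \sum_(j < size p)
    p`_i * p`_j * (b i j * cos ((i%:R - j%:R) * t))).
  by apply/funext => t; exact: energyE.
move=> t; apply: cvg_big => [|i _]; first exact: add_continuous.
apply: cvg_big => [|j _]; first exact: add_continuous.
do 2 apply: cvgMl_tmp.
apply: (@cvg_comp _ _ _ (fun t => (i%:R - j%:R) * t) (@cos R));
  last exact: continuous_cos.
exact: mulrl_continuous.
Qed.

Lemma near_energy_cesaro_poly_lt t p c : p.[1] = 1 -> energy t p < c ->
  \forall s \near t & n \near \oo, energy s (cesaro_poly n) < c.
Proof.
move=> p1; have := energy_ge0 t p; set a := energy t p => a0 ac.
have [r rP] := energy_cesaro_poly_le p1.
have [e e0 eac] := exists_gt1M_lt a0 ac.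
pose m := ((1 + e) * a + c) / 2.
have near_p : \forall s \near t, (1 + e) * energy s p < m.
  have cvg_p : (1 + e) * energy s p @[s --> t] --> (1 + e) * a.
    by apply: cvgMl_tmp; exact: (@continuous_energy p t).
  by apply: (cvgr_lt _ cvg_p); rewrite /m; lra.
have near_r : \forall s \near t, energy s r < energy t r + 1.
  by apply: (cvgr_lt _ (@continuous_energy r t)); rewrite ltrDl.
pose K := (1 + e^-1) * (4 * (energy t r + 1)).
have near_n : \forall n \near \oo, K * n%:R^-1 ^+ 2 < c - m.
  have cvg_n : K * n%:R^-1 ^+ 2 @[n --> \oo] --> K * (0 * 0).
    by apply: cvgMl_tmp; under eq_cvg do rewrite expr2; apply: cvgM; exact: cvg_invn.
  by apply: (cvgr_lt _ cvg_n); rewrite /m; lra.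
near=> s n; apply: le_lt_trans (rP s e n e0) _.
have sp : (1 + e) * energy s p < m by near: s.
have nK : K * n%:R^-1 ^+ 2 < c - m by near: n.
suff : (1 + e^-1) * (4 * energy s r / n%:R ^+ 2) <= K * n%:R^-1 ^+ 2 by lra.
rewrite /K exprVn -!mulrA ler_wpM2l ?addr_ge0 ?invr_ge0 ?(ltW e0)//.
by rewrite !ler_wpM2l// ler_wpM2r ?invr_ge0 ?exprn_ge0// ltW//; near: s.
Unshelve. all: by end_near. Qed.

Definition energy_inf t := inf [set energy t p | p in [set p | p.[1] = 1]].

Let energies_has_inf t : has_inf [set energy t p | p in [set p | p.[1] = 1]].
Proof.
split; first by exists (energy t 1); exists 1 => //=; rewrite hornerC.
by exists 0 => _ [p _ <-]; exact: energy_ge0.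
Qed.

Lemma energy_inf_le t p : p.[1] = 1 -> energy_inf t <= energy t p.
Proof. by move=> p1; apply: ge_inf; [case: (energies_has_inf t)|exists p]. Qed.

Lemma energy_inf_lt t c : energy_inf t < c -> exists2 p, p.[1] = 1 & energy t p < c.
Proof.
rewrite -subr_gt0 => c0; have [_ [p p1 <-]] := inf_adherent c0 (energies_has_inf t).
by rewrite addrC subrK => pc; exists p.
Qed.

Lemma cvg_energy_cesaro_poly t : energy t (cesaro_poly n) @[n --> \oo] --> energy_inf t.
Proof.
apply/cvgrPdist_lt => e e0.
have [|p p1 pe] := @energy_inf_lt t (energy_inf t + e); first by rewrite ltrDl.
have [[A B] [/= /nbhs_singleton At nB] AB] := near_energy_cesaro_poly_lt p1 pe.
near=> n; have n0 : (0 < n)%N by near: n; exists 1%N.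
have := energy_inf_le t (horner1_cesaro_poly n0).
have : energy t (cesaro_poly n) < energy_inf t + e.
  by apply: (AB (t, n)); split => //=; near: n.
by move=> lt_e ge_inf; rewrite distrC ger0_norm ?subr_ge0//; lra.
Unshelve. all: by end_near. Qed.

Lemma energy_minimizers_close t p r c : p.[1] = 1 -> r.[1] = 1 ->
  energy t p <= energy_inf t + c -> energy t r <= energy_inf t + c ->
  energy t (p - r) <= 4 * c.
Proof.
move=> p1 r1 pc rc; have := energy_parallelogram t p r.
suff : 4 * energy_inf t <= energy t (p + r) by lra.
have -> : p + r = 2 *: (2^-1 *: (p + r)) by rewrite scalerA divff ?scale1r// pnatr_eq0.
rewrite energyZ -natrX ler_pM2l// energy_inf_le//.
by rewrite !hornerE p1 r1; field.
Qed.

Lemma exists_fast_minimizing_cesaro t : exists N : nat -> nat,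
  (forall j, (j < N j)%N) /\
  forall j, energy t (cesaro_poly (N j) - cesaro_poly (N j.+1)) <= 4 * 8^-1 ^+ j.
Proof.
have /choice[N NP] j : exists n,
    (j < n)%N /\ energy t (cesaro_poly n) <= energy_inf t + 8^-1 ^+ j.
  have : energy_inf t < energy_inf t + 8^-1 ^+ j by rewrite ltrDl exprn_gt0// invr_gt0.
  move=> /(cvgr_lt _ (@cvg_energy_cesaro_poly t))[m _ mP].
  exists (maxn m j.+1); split; first by rewrite leq_max leqnn orbT.
  by apply/ltW/mP; rewrite /= leq_max leqnn.
have N0 j : (0 < N j)%N by have [+ _] := NP j; exact: leq_ltn_trans.
exists N; split=> [j|j]; first by have [] := NP j.
have [_ Nj] := NP j; have [_ NSj] := NP j.+1.
apply: energy_minimizers_close Nj _; [exact: horner1_cesaro_poly..|].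
by rewrite (le_trans NSj)// lerD2l exprS ler_piMl ?exprn_ge0 ?invr_ge0// invf_le1// ler1n.
Qed.

Lemma cvg_coef_dotXM_cesaro_poly (u : nat -> R) (N : nat -> nat) (l M : R) :
  (forall j, (j < N j)%N) -> (forall i, `|u i| <= M) ->
  coef_dot u (cesaro_poly (N j)) @[j --> \oo] --> l ->
  coef_dot u ('X * cesaro_poly (N j)) @[j --> \oo] --> l.
Proof.
move=> ltN uM ul; rewrite -[l]add0r.
have -> : (fun j => coef_dot u ('X * cesaro_poly (N j))) = (fun j =>
    (coef_dot u ('X * cesaro_poly (N j)) - coef_dot u (cesaro_poly (N j))) +
    coef_dot u (cesaro_poly (N j))) by apply/funext => j; rewrite subrK.
apply: cvgD => //; have N_infty : N @ \oo --> \oo.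
  by move=> A [m _ mA]; exists m => // j /= mj; apply: mA => /=;
    exact: leq_trans mj (ltnW (ltN j)).
under eq_cvg do rewrite coef_dotXM !coef_dot_cesaro_poly.
exact: (cvg_comp _ _ N_infty (cesaro_meanS_subr_cvg0 uM)).
Qed.

Lemma exists_cesaro_limit (w : nat -> R) (N : nat -> nat) c :
  (forall i, `|w i| <= 1) -> (forall j, (j < N j)%N) ->
  (forall j, 'E (fun x =>
    orbit_sum w (cesaro_poly (N j) - cesaro_poly (N j.+1)) x ^+ 2) <= c * 8^-1 ^+ j) ->
  exists F : Omega -> R, [/\ measurable_fun setT F,
    forall x (l : R), orbit_sum w (cesaro_poly (N j)) x @[j --> \oo] --> l -> F x = l &
    {ae Q, forall x, orbit_sum w (cesaro_poly (N j)) x @[j --> \oo] --> F x /\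
                     orbit_sum w ('X * cesaro_poly (N j)) x @[j --> \oo] --> F x}].
Proof.
move=> w1 ltN fastN; have [_ [M fM]] := bf.
pose A j := orbit_sum w (cesaro_poly (N j)).
have wfM x i : `|w i * f (iter i T x)| <= M.
  by rewrite normrM (le_trans (ler_piMl _ (w1 i))).
have AM j x : `|A j x| <= M.
  by rewrite /A /orbit_sum coef_dot_cesaro_poly; exact: norm_cesaro_mean_le.
have bA j := bounded_mfun_orbit_sum w (cesaro_poly (N j)).
have [F mF AF] := exists_measurable_limit (fun j => (bA j).1) AM.
exists F; split => //.
have fastA j : 'E (fun x => (A j x - A j.+1 x) ^+ 2) <= c * 8^-1 ^+ j.
  by under eq_Rintegral do rewrite /A /orbit_sum -coef_dotB; exact: fastN.
apply: filterS (ae_cvgn_fast_mean_square bA fastA) => x /cvg_ex[l Al].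
rewrite (AF _ _ Al); split; first exact: Al.
exact: cvg_coef_dotXM_cesaro_poly ltN (wfM x) Al.
Qed.

(* Along a fast minimizing sequence the rotated Cesaro means converge almost
   everywhere, to an eigenfunction [F + iG] for the eigenvalue [e^(-it)]. *)
Lemma exists_cesaro_limit_eigenfunction t (N : nat -> nat) :
  (forall j, (j < N j)%N) ->
  (forall j, energy t (cesaro_poly (N j) - cesaro_poly (N j.+1)) <= 4 * 8^-1 ^+ j) ->
  exists F G : Omega -> R, [/\ measurable_fun setT F, measurable_fun setT G,
    {ae Q, forall x, cos_part t (cesaro_poly (N j)) x @[j --> \oo] --> F x},
    {ae Q, forall x, sin_part t (cesaro_poly (N j)) x @[j --> \oo] --> G x} &
    {ae Q, forall x, (F (T x) +i* G (T x) = (cos t +i* - sin t) * (F x +i* G x))%C}].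
Proof.
move=> ltN fastN.
have [|F [mF CF aeF]] := exists_cesaro_limit (fun i => cos_max (i%:R * t)) ltN (c := 4).
  by move=> j; apply: le_trans (fastN j); exact: expect_cos_part_sqr_le.
have [|G [mG SG aeG]] := exists_cesaro_limit (fun i => sin_max (i%:R * t)) ltN (c := 4).
  by move=> j; apply: le_trans (fastN j); exact: expect_sin_part_sqr_le.
exists F, G; split => //.
- by apply: filterS aeF => x [].
- by apply: filterS aeG => x [].
apply: filterS2 aeF aeG => x [_ CXF] [_ SXG].
have -> : F (T x) = cos t * F x + sin t * G x.
  apply: CF; under eq_cvg do rewrite -/(cos_part t) cos_part_comp.
  by apply: cvgD; exact: cvgMl_tmp.
have -> : G (T x) = cos t * G x - sin t * F x.
  apply: SG; under eq_cvg do rewrite -/(sin_part t) sin_part_comp.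
  by apply: cvgB; exact: cvgMl_tmp.
by apply/eqP; rewrite eq_complex /=; apply/andP; split; apply/eqP; ring.
Qed.

Hypothesis Ef0 : 'E f = 0.

Lemma expect_orbit_sum w p : 'E (orbit_sum w p) = 0.
Proof.
have bw i : bounded_mfun (fun x => w i * f (iter i T x)).
  by apply: bounded_mfunZ; exact: bounded_mfun_iter.
rewrite /orbit_sum /coef_dot expect_sum => [|i]; last exact: bounded_mfunZ.
rewrite big1// => i _; rewrite !expectZ//; last exact: bounded_mfun_iter.
by rewrite expect_iter// Ef0 !mulr0.
Qed.

Lemma expect_orbit_sum_sqr_cvg0 (w : nat -> R) (N : nat -> nat) c :
  (forall i, `|w i| <= 1) ->
  {ae Q, forall x, orbit_sum w (cesaro_poly (N j)) x @[j --> \oo] --> c} ->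
  'E (fun x => orbit_sum w (cesaro_poly (N j)) x ^+ 2) @[j --> \oo] --> (0 : R).
Proof.
move=> w1 wc; have [_ [M fM]] := bf.
have bA j := bounded_mfun_orbit_sum w (cesaro_poly (N j)).
have [j x|Ec Ec2] := expect_cvg_cst (fun j => (bA j).1) _ wc (M := M).
  rewrite /orbit_sum coef_dot_cesaro_poly norm_cesaro_mean_le// => i.
  by rewrite normrM (le_trans (ler_piMl _ (w1 i))).
suff c0 : c = 0 by rewrite c0 expr0n in Ec2.
apply: cvg_unique Ec _ => //; apply: cvg_near_cst.
by apply: nearW => j; exact: expect_orbit_sum.
Qed.

Hypothesis wQ : cap_weakly_mixing T (fun A => fine (Q A)).

Lemma energy_inf_eq0 t : energy_inf t = 0.
Proof.
have [N [ltN fastN]] := exists_fast_minimizing_cesaro t.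
have [F [G [mF mG CF SG FGT]]] := exists_cesaro_limit_eigenfunction ltN fastN.
have [||c /cap_as_fine_prob FGc] := wQ (f := fun x => (F x +i* G x)%C)
  (lam := (cos t +i* - sin t)%C); [by split|exact/cap_as_fine_prob|].
have cvg_energy : energy t (cesaro_poly (N j)) @[j --> \oo] --> (0 + 0 : R).
  under eq_cvg do rewrite energy_parts.
  apply: cvgD; [apply: (expect_orbit_sum_sqr_cvg0 (c := complex.Re c))|
                apply: (expect_orbit_sum_sqr_cvg0 (c := complex.Im c))].
  - by move=> i; exact: cos_max.
  - by apply: filterS2 CF FGc => x + <-.
  - by move=> i; exact: sin_max.
  - by apply: filterS2 SG FGc => x + <-.
apply/eqP; rewrite eq_le; apply/andP; split; last first.
  by apply: lb_le_inf => [|_ [p _ <-]]; [case: (energies_has_inf t)|exact: energy_ge0].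
rewrite -[leRHS]addr0 -(cvg_lim _ cvg_energy)//.
apply: limr_ge; first exact: cvgP cvg_energy.
apply: nearW => j; apply/energy_inf_le/horner1_cesaro_poly.
exact: leq_ltn_trans (ltN j).
Qed.

Lemma near_energy_cesaro_poly_lt_uniform e : 0 < e ->
  \forall n \near \oo, forall t, 0 <= t <= 2 * pi -> energy t (cesaro_poly n) < e.
Proof.
move=> e0; have := @segment_compact R 0 (2 * pi); rewrite compact_near_coveringP.
move=> /(_ nat \oo (fun n t => energy t (cesaro_poly n) < e) _) unif.
have : \forall n \near \oo,
    `[0, 2 * pi]%classic `<=` (fun t => energy t (cesaro_poly n) < e).
  apply: unif => t _; have [|p p1 pe] := @energy_inf_lt t e.
    by rewrite energy_inf_eq0.
  exact: near_energy_cesaro_poly_lt pe.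
by apply: filterS => n en t t2; apply: en; rewrite /= in_itv.
Qed.

Lemma autocorrelation_sqr_cvg0 :
  cesaro_mean2 (fun i j => b i j ^+ 2) @ \oo --> (0 : R).
Proof.
apply/cvgrPdist_le => e e0.
have b0 : 0 < b 0 0 + 1 by rewrite ltr_wpDl ?autocorrelation00_ge0.
have [m _ unif] := near_energy_cesaro_poly_lt_uniform
  (divr_gt0 e0 (mulr_gt0 (ltr0Sn R 15) b0)).
set e' := e / _ in unif.
exists m.+1 => // n /= mn; have n0 : (0 < n)%N by exact: leq_ltn_trans mn.
have n2 : 0 < (2 * n)%:R ^+ 2 :> R by rewrite exprn_gt0// ltr0n muln_gt0.
have formE t : toeplitz_form b (2 * n) t =
    (2 * n)%:R ^+ 2 * energy t (cesaro_poly (2 * n)).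
  by rewrite energy_cesaro_poly mulVKf// gt_eqF.
rewrite sub0r normrN ger0_norm; last by apply: cesaro_mean2_ge0 => i j; exact: sqr_ge0.
rewrite cesaro_mean2E ler_pdivrMl ?exprn_gt0 ?ltr0n//.
apply: (le_trans (toeplitz_sum_sqr_le autocorrelation_shift autocorrelation_sym
  (s := (2 * n)%:R ^+ 2 * e') n0 _ _)).
- by move=> t; rewrite formE mulr_ge0 ?energy_ge0// ltW.
- move=> t t2; rewrite formE ler_pM2l//; apply/ltW/unif => //=.
  by rewrite (leq_trans (ltnW mn))// leq_pmull.
have -> : 4 * b 0 0 * ((2 * n)%:R ^+ 2 * e') = n%:R ^+ 2 * e * (b 0 0 / (b 0 0 + 1)).
  by rewrite /e' natrM; field; rewrite gt_eqF.
by rewrite ler_piMr ?mulr_ge0 ?exprn_ge0 ?(ltW e0)// ler_pdivrMr// mul1r lerDl.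
Qed.

End energy.

Section decorrelation.
Context {d : measure_display} {Omega : measurableType d} {R : realType}.
Variables (T : Omega -> Omega) (Q : probability Omega R).
Hypotheses (mT : measurable_fun setT T) (iQ : invariant_prob T Q).
Implicit Types (A B C : set Omega) (P : probability Omega R) (i j n : nat).

Definition cesaro_mixing (P : set Omega -> R) B C :=
  cesaro_mean (fun i => `|P (B `&` iter i T @^-1` C) - P B * fine (Q C)| ^+ 2) @ \oo
    --> (0 : R).

Definition decorrelated C :=
  cesaro_mean2 (fun i j => `|autocorrelation Q T (centered_indic Q C) i j|) @ \oo
    --> (0 : R).

Lemma eq_cesaro_mixing (P P' : set Omega -> R) B C : measurable B -> measurable C ->
  (forall A, measurable A -> P A = P' A) -> cesaro_mixing P B C -> cesaro_mixing P' B C.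
Proof.
move=> mB mC PP'; have mBC i : measurable (B `&` iter i T @^-1` C).
  by apply: measurableI => //; exact: measurable_preimage_iter.
have dev_eq : (fun i => `|P (B `&` iter i T @^-1` C) - P B * fine (Q C)| ^+ 2) =
    (fun i => `|P' (B `&` iter i T @^-1` C) - P' B * fine (Q C)| ^+ 2).
  by apply/funext => i; rewrite !PP'.
by rewrite /cesaro_mixing dev_eq.
Qed.

Let centered_indic_iter C i x : measurable C ->
  centered_indic Q C (iter i T x) = centered_indic Q (iter i T @^-1` C) x.
Proof.
by move=> mC; rewrite /centered_indic -[Q C](invariant_prob_iter mT i iQ mC).
Qed.

Lemma autocorrelation_centered_indic C i j : measurable C ->
  autocorrelation Q T (centered_indic Q C) i j =
  fine (Q (iter i T @^-1` C `&` iter j T @^-1` C)) - fine (Q C) ^+ 2.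
Proof.
move=> mC; rewrite /autocorrelation.
under eq_Rintegral do rewrite !centered_indic_iter//.
rewrite expect_centered_indicM; [|exact: measurable_preimage_iter..].
rewrite [Q (iter i T @^-1` C)](invariant_prob_iter mT i iQ mC).
by rewrite [Q (iter j T @^-1` C)](invariant_prob_iter mT j iQ mC) expr2.
Qed.

Lemma weakly_mixing_decorrelated C : cap_weakly_mixing T (fun A => fine (Q A)) ->
  measurable C -> decorrelated C.
Proof.
move=> wQ mC; apply: cesaro_mean2_norm_cvg0; apply: autocorrelation_sqr_cvg0 => //.
  exact: bounded_mfun_centered_indic.
exact: expect_centered_indic.
Qed.

(* With [a i] the correlation of [B] and [T^-i C] under [P] and [f = 1_C - Q C], the
   mean of the [a i ^ 2] is [E_P (1_B h_n)] for [h_n = n^-1 sum_i a_i f o T^i],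
   and [h_n] tends to [0] in mean square under [Q]. *)
Lemma decorrelated_cesaro_mixing P B C : P `<< Q -> measurable B -> measurable C ->
  decorrelated C -> cesaro_mixing (fun A => fine (P A)) B C.
Proof.
move=> PQ mB mC dC; pose f := centered_indic Q C.
have mTC i : measurable (iter i T @^-1` C) by exact: measurable_preimage_iter.
have bf i : bounded_mfun (fun x => f (iter i T x)).
  exact/bounded_mfun_iter/bounded_mfun_centered_indic.
pose a i := fine (P (B `&` iter i T @^-1` C)) - fine (P B) * fine (Q C).
have aE i : a i = \int[P]_x (\1_B x * f (iter i T x)).
  by rewrite /a -expect_indic_subr_cst.
have a1 i : `|a i| <= 1.
  have := fine_prob_ge0 P (B `&` iter i T @^-1` C).
  have := fine_prob_le1 P (measurableI _ _ mB (mTC i)).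
  have := mulr_ge0 (fine_prob_ge0 P B) (fine_prob_ge0 Q C).
  have := mulr_ile1 (fine_prob_ge0 P B) (fine_prob_ge0 Q C) (fine_prob_le1 P mB)
    (fine_prob_le1 Q mC).
  by move=> *; rewrite ler_norml /a; apply/andP; split; lra.
pose h n x := cesaro_mean (fun i => a i * f (iter i T x)) n.
have mh n : measurable_fun setT (h n).
  by apply: (bounded_mfun_cesaro_mean _ _).1 => i; exact: bounded_mfunZ.
have h1 n x : `|h n x| <= 1.
  apply: norm_cesaro_mean_le => i.
  by rewrite normrM mulr_ile1// norm_centered_indic_le1.
have meanE n : cesaro_mean (fun i => `|a i| ^+ 2) n = \int[P]_x (\1_B x * h n x).
  under [RHS]eq_Rintegral do rewrite -cesaro_meanZ.
  have bBf i : bounded_mfun (fun x => \1_B x * f (iter i T x)).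
    by apply: bounded_mfunM => //; exact: bounded_mfun_indic.
  under [RHS]eq_Rintegral => x _ do under eq_fun do rewrite mulrCA.
  rewrite (@expect_cesaro_mean _ _ _ P (fun i x => a i * (\1_B x * f (iter i T x)))).
    congr cesaro_mean; apply/funext => i.
    by rewrite expectZ// -aE real_normK ?num_real// expr2.
  by move=> i; exact: bounded_mfunZ.
have h0 : \int[Q]_x (h n x ^+ 2) @[n --> \oo] --> (0 : R).
  exact: (expect_sqr_cesaro_mean_cvg0 bf a1 dC).
rewrite /cesaro_mixing (_ : cesaro_mean _ = (fun n => \int[P]_x (\1_B x * h n x))).
  exact: dominated_expectM_cvg0 PQ mh h1 h0 (bounded_mfun_indic mB).
by apply/funext => n; exact: meanE.
Qed.

End decorrelation.

(** * The product system *)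

Section product_system.
Context {d : measure_display} {Omega : measurableType d} {R : realType}.
Variables (T : Omega -> Omega) (Q : probability Omega R).
Hypotheses (mT : measurable_fun setT T) (iQ : invariant_prob T Q).
Implicit Types (B C : set Omega) (A : set (Omega * Omega)).

Let mu : probability (Omega * Omega)%type R := (Q \x Q)%E.

Definition square_map (z : Omega * Omega) := (T z.1, T z.2).

Lemma measurable_square_map : measurable_fun setT square_map.
Proof.
by apply: measurable_fun_pair; apply: (measurableT_comp mT);
  [exact: measurable_fst|exact: measurable_snd].
Qed.

Let muX B C : measurable B -> measurable C -> mu (B `*` C) = (Q B * Q C)%E.
Proof. exact: product_measure1E. Qed.

Let fine_muX B C : measurable B -> measurable C ->
  fine (mu (B `*` C)) = fine (Q B) * fine (Q C).
Proof. by move=> mB mC; rewrite muX// fineM// fin_num_measure. Qed.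

Lemma square_map_invariant : invariant_prob square_map mu.
Proof.
move=> A mA; apply/esym; have mS := measurable_square_map.
apply: (@product_measure_unique _ _ _ _ R Q Q (pushforward mu square_map)) => //.
move=> B C mB mC; have mTX X : measurable X -> measurable (T @^-1` X).
  by move=> mX; rewrite -[X in measurable X]setTI; exact: mT.
transitivity (mu ((T @^-1` B) `*` (T @^-1` C))); first by [].
by rewrite muX ?iQ//; exact: mTX.
Qed.

Lemma preimage_iter_square_map i B C : iter i square_map @^-1` (B `*` C) =
  (iter i T @^-1` B) `*` (iter i T @^-1` C).
Proof.
have iterE z : iter i square_map z = (iter i T z.1, iter i T z.2).
  by elim: i => [|i /= ->]; first by case: z.
by apply/seteqP; split => z; rewrite /preimage/= iterE.
Qed.

Lemma square_autocorrelation_le B C i j : measurable B -> measurable C ->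
  `|autocorrelation mu square_map (centered_indic mu (B `*` C)) i j| <=
  `|autocorrelation Q T (centered_indic Q B) i j| +
  `|autocorrelation Q T (centered_indic Q C) i j|.
Proof.
move=> mB mC; have mX := measurableX mB mC.
have muS := square_map_invariant.
rewrite (autocorrelation_centered_indic measurable_square_map muS _ _ mX).
rewrite !autocorrelation_centered_indic// !preimage_iter_square_map.
have mTI X : measurable X -> measurable (iter i T @^-1` X `&` iter j T @^-1` X).
  by move=> mX'; apply: measurableI; exact: measurable_preimage_iter.
rewrite -setXI !fine_muX//; [|exact: mTI..].
set x := fine (Q (_ `&` _)); set y := fine (Q (_ `&` _)).
set x0 := fine (Q B); set y0 := fine (Q C).
have -> : x * y - (x0 * y0) ^+ 2 = (x - x0 ^+ 2) * y + x0 ^+ 2 * (y - y0 ^+ 2) by ring.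
have y1 : `|y| <= 1 by apply: norm_fine_prob_le1; exact: mTI.
have x1 : `|x0 ^+ 2| <= 1 by rewrite normrX expr_le1// norm_fine_prob_le1.
rewrite (le_trans (ler_normD _ _))//.
by apply: lerD; rewrite normrM ?ler_piMr// ler_piMl.
Qed.

Lemma decorrelatedX B C : measurable B -> measurable C ->
  decorrelated T Q B -> decorrelated T Q C -> decorrelated square_map mu (B `*` C).
Proof.
move=> mB mC dB dC.
have dBC : cesaro_mean2 (fun i j => `|autocorrelation Q T (centered_indic Q B) i j|) n +
    cesaro_mean2 (fun i j => `|autocorrelation Q T (centered_indic Q C) i j|) n
    @[n --> \oo] --> (0 : R) by rewrite -[X in _ --> X]addr0; exact: cvgD.
apply: squeeze_cvgr (cvg_cst 0) dBC; apply: nearW => n.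
rewrite cesaro_mean2_ge0//= -cesaro_mean2D.
by apply: le_cesaro_mean2 => i j; exact: square_autocorrelation_le.
Qed.

Lemma invariant_rectangle A B C : measurable A -> square_map @^-1` A = A ->
  measurable B -> measurable C -> decorrelated T Q B -> decorrelated T Q C ->
  fine (mu (A `&` (B `*` C))) = fine (mu A) * (fine (Q B) * fine (Q C)).
Proof.
move=> mA SA mB mC dB dC; rewrite -fine_muX//; have mX := measurableX mB mC.
have meetE i : fine (mu (A `&` iter i square_map @^-1` (B `*` C))) =
    fine (mu (A `&` (B `*` C))).
  rewrite -{1}(preimage_iter_invariant i SA) -preimage_setI; congr fine.
  apply: (invariant_prob_iter measurable_square_map i square_map_invariant).
  exact: measurableI.
have mixA := decorrelated_cesaro_mixing measurable_square_map
  (@subset_refl _ mu.-null_set) mA mX (decorrelatedX mB mC dB dC).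
apply/eqP; rewrite -subr_eq0 -normr_eq0 -sqrf_eq0 eq_le sqr_ge0 andbT.
rewrite leNgt; apply/negP => neq0.
by have [i neqi] := cesaro_mean_cvg0_exists_lt mixA neq0; rewrite meetE ltxx in neqi.
Qed.

Lemma decorrelated_weakly_mixing_prob :
  (forall B, measurable B -> decorrelated T Q B) -> weakly_mixing_prob T Q.
Proof.
move=> dQ; split => // A mA SA; rewrite -[(Q \x Q)%E A]/(mu A).
have [->|A0] := eqVneq (mu A) 0%E; [by left|right].
have a0 : 0 < fine (mu A) by rewrite fine_prob_gt0.
have ai0 : 0 <= (fine (mu A))^-1 by rewrite invr_ge0 ltW.
pose cond_mu := mscale (NngNum ai0) (mrestr mu mA).
have condA : cond_mu A = 1%E.
  transitivity (((fine (mu A))^-1)%:E * mu (A `&` A))%E; first by [].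
  by rewrite setIid -(fine_probK mu mA) -EFinM mulVf// gt_eqF.
rewrite -condA; apply: (@product_measure_unique _ _ _ _ R Q Q cond_mu) => // B C mB mC.
transitivity (((fine (mu A))^-1)%:E * mu (B `*` C `&` A))%E; first by [].
have mAX : measurable (A `&` (B `*` C)) by apply: measurableI => //; exact: measurableX.
rewrite setIC -[X in (_ * X)%E](fine_probK mu)// invariant_rectangle//; try exact: dQ.
by rewrite -EFinM mulKf ?gt_eqF// EFinM !fine_probK.
Qed.

End product_system.

(** * Eigenfunctions of a mixing measure *)

Section almost_everywhere_constant.
Context {d : measure_display} {Omega : measurableType d} {R : realType}.
Variable Q : probability Omega R.
Implicit Types (A B : set Omega) (g : Omega -> R) (a b e : R).

Lemma exists_prob_gt0_small_oscillation A g e : measurable A -> 0 < fine (Q A) ->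
  measurable_fun setT g -> 0 < e ->
  exists B, [/\ measurable B, B `<=` A, 0 < fine (Q B) &
    forall x y, B x -> B y -> `|g x - g y| < e].
Proof.
move=> mA A0 mg e0.
pose cell (z : int) := [set x | z%:~R * e <= g x] `&` ~` [set x | (z + 1)%:~R * e <= g x].
have mcell z : measurable (cell z).
  by apply: measurableI; last apply: measurableC; exact: measurable_ge_cst.
have [|z z0] := exists_prob_gt0_of_cover mA mcell A0.
  move=> x _; exists (Num.floor (g x / e)) => //.
  have /andP[lo hi] := floor_itv (g x / e).
  by split => /=; [rewrite -ler_pdivlMr//|apply/negP; rewrite -ltNge -ltr_pdivrMr//].
exists (A `&` cell z); split => //; first exact: measurableI.
move=> x y [_ [/= lox /negP hix]] [_ [/= loy /negP hiy]].
rewrite -!ltNge intrD mulrDl mul1r in hix hiy.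
by rewrite ltr_norml; apply/andP; split; lra.
Qed.

Lemma exists_prob_gt0_le g : measurable_fun setT g ->
  exists a, 0 < fine (Q [set x | g x <= a]).
Proof.
move=> mg; have QT : 0 < fine (Q setT) by rewrite probability_setT.
have cover : setT `<=` \bigcup_n [set x | g x <= n%:R].
  by move=> x _; exists (Num.truncn (g x)).+1 => //=; rewrite ltW// truncnS_gt.
have mle n : measurable [set x | g x <= n%:R] by exact: measurable_le_cst.
have [n] := exists_prob_gt0_of_cover measurableT mle QT cover.
by rewrite setTI; exists n%:R.
Qed.

Lemma ae_eq0_of_norm_lt g : (forall e, 0 < e -> {ae Q, forall x, `|g x| < e}) ->
  {ae Q, forall x, g x = 0}.
Proof.
move=> g_small; have g_invn n : {ae Q, forall x, `|g x| < n.+1%:R^-1}.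
  by apply: g_small; rewrite invr_gt0.
apply: filterS (ae_foralln g_invn) => x gx; apply/eqP; rewrite -normr_le0.
apply/ler_addgt0Pl => e e0; rewrite addr0 ltW// (lt_le_trans (gx (Num.truncn e^-1)))//.
by rewrite -[leRHS]invrK lef_pV2 ?posrE ?invr_gt0// ltW// truncnS_gt.
Qed.

Lemma exists_ae_constant g : measurable_fun setT g ->
  (forall a b, a < b -> 0 < fine (Q [set x | g x <= a]) ->
     0 < fine (Q [set x | b <= g x]) -> False) ->
  exists c, {ae Q, forall x, g x = c}.
Proof.
move=> mg gab; pose S := [set a | 0 < fine (Q [set x | g x <= a])].
have [a0 Sa0] : S !=set0 by exact: exists_prob_gt0_le.
have [a1] := exists_prob_gt0_le (measurableT_comp (@oppr_measurable R _) mg).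
under eq_set do rewrite lerNl; move=> a1_gt0.
have infS : has_inf S.
  split; first by exists a0.
  by exists (- a1) => a Sa; rewrite leNgt; apply/negP => /gab; apply.
have ae_of_le0 (A : set Omega) (p : Omega -> Prop) : measurable A ->
    ~ 0 < fine (Q A) -> (forall x, ~ A x -> p x) -> {ae Q, forall x, p x}.
  move=> mA /negP; rewrite -leNgt => /(fine_prob_le0 mA) QA Ap.
  by exists A; split => // x; apply: contra_notP => /Ap.
exists (inf S); suff : {ae Q, forall x, g x - inf S = 0}.
  by apply: filterS => x /eqP; rewrite subr_eq0 => /eqP.
apply: ae_eq0_of_norm_lt => r r0.
have lo : {ae Q, forall x, inf S - r < g x}.
  apply: (ae_of_le0 [set x | g x <= inf S - r]).
  - exact: measurable_le_cst.
  - by move=> Sr; have := ge_inf infS.2 (Sr : S _); lra.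
  - by move=> x /= /negP; rewrite -ltNge.
have hi : {ae Q, forall x, g x < inf S + r}.
  apply: (ae_of_le0 [set x | inf S + r <= g x]).
  - exact: measurable_ge_cst.
  - by move=> Qr; have [a Sa /gab] := inf_adherent r0 infS; apply.
  - by move=> x /= /negP; rewrite -ltNge.
by apply: filterS2 lo hi => x lox hix; rewrite ltr_norml; apply/andP; split; lra.
Qed.

End almost_everywhere_constant.

Section complex_modulus.
Context {R : realType}.
Implicit Types (z w : R[i]) (n : nat).
Import ComplexField.Normc.

Lemma normc_ge0 z : 0 <= normc z.
Proof. by case: z => a b; exact: sqrtr_ge0. Qed.

Lemma normcX z n : normc (z ^+ n) = normc z ^+ n.
Proof. by elim: n => [|n ih]; rewrite ?expr0 ?normc1// !exprS normcM ih. Qed.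

Lemma sqr_normcE z : normc z ^+ 2 = complex.Re z ^+ 2 + complex.Im z ^+ 2.
Proof. by case: z => a b /=; rewrite sqr_sqrtr// addr_ge0 ?sqr_ge0. Qed.

Lemma norm_ReB_le_normc z w : `|complex.Re z - complex.Re w| <= normc (z - w).
Proof.
by case: z w => [a b] [a' b'] /=; rewrite -sqrtr_sqr ler_wsqrtr// lerDl sqr_ge0.
Qed.

Lemma norm_ImB_le_normc z w : `|complex.Im z - complex.Im w| <= normc (z - w).
Proof.
by case: z w => [a b] [a' b'] /=; rewrite -sqrtr_sqr ler_wsqrtr// lerDr sqr_ge0.
Qed.

Lemma normcB_le z w : normc (z - w) <=
  `|complex.Re z - complex.Re w| + `|complex.Im z - complex.Im w|.
Proof.
case: z w => [a b] [a' b'] /=; set x := a - a'; set y := b - b'.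
rewrite -[leRHS]ger0_norm ?addr_ge0// -sqrtr_sqr ler_wsqrtr//.
by rewrite [leRHS]sqrrD !real_normK ?num_real// lerD2r lerDl mulrn_wge0// mulr_ge0.
Qed.

End complex_modulus.

Lemma exists_lt_exprn (R : realType) (x y : R) : 1 < x -> exists n, y < x ^+ n.
Proof.
move=> x1; have x0 : 0 < x by exact: lt_trans x1.
have xV1 : `|x^-1| < 1 by rewrite ger0_norm ?invr_ge0 ?(ltW x0)// invf_lt1.
have y0 : 0 < (`|y| + 1)^-1 by rewrite invr_gt0 ltr_wpDl.
have [n _ /(_ n (leqnn n))] := cvgr_lt _ (cvg_expr xV1) _ y0.
rewrite /= exprVn ltf_pV2 ?posrE ?exprn_gt0 ?ltr_wpDl// => yx; exists n.
by apply: le_lt_trans yx; rewrite (le_trans (ler_norm y))// lerDl.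
Qed.

Section mixing_eigenfunctions.
Context {d : measure_display} {Omega : measurableType d} {R : realType}.
Variables (T : Omega -> Omega) (Q : probability Omega R).
Hypotheses (mT : measurable_fun setT T) (iQ : invariant_prob T Q).
Hypothesis mixQ : forall B C, measurable B -> measurable C ->
  cesaro_mixing T Q (fun A => fine (Q A)) B C.
Import ComplexField.Normc.

Lemma mixing_joint_recurrence B C1 C2 :
  measurable B -> measurable C1 -> measurable C2 ->
  0 < fine (Q B) -> 0 < fine (Q C1) -> 0 < fine (Q C2) ->
  exists i, 0 < fine (Q (B `&` iter i T @^-1` C1)) /\
            0 < fine (Q (B `&` iter i T @^-1` C2)).
Proof.
move=> mB m1 m2 B0 C10 C20; pose q := fine (Q B).
pose dev C i := `|fine (Q (B `&` iter i T @^-1` C)) - q * fine (Q C)| ^+ 2.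
have dev_cvg0 : cesaro_mean (fun i => dev C1 i + dev C2 i) @ \oo --> (0 : R).
  rewrite -[X in _ --> X]addr0; under eq_cvg do rewrite cesaro_meanD.
  by apply: cvgD; exact: mixQ.
pose c := Num.min (q * fine (Q C1)) (q * fine (Q C2)).
have c0 : 0 < c by rewrite lt_min !mulr_gt0.
have [i devi] := cesaro_mean_cvg0_exists_lt dev_cvg0 (exprn_gt0 2 c0).
have meet_gt0 C : c <= q * fine (Q C) -> dev C i < c ^+ 2 ->
    0 < fine (Q (B `&` iter i T @^-1` C)).
  move=> cC; rewrite /dev ltr_sqr ?nnegrE ?(ltW c0)// ltr_norml => /andP[lo _].
  by move: lo; lra.
by exists i; split; apply: meet_gt0; rewrite ?ge_min ?lexx ?orbT//;
  apply: le_lt_trans devi; rewrite ?lerDl ?lerDr exprn_ge0.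
Qed.

Section eigenfunction.
Variables (f : Omega -> R[i]) (lam : R[i]).
Hypothesis mf : measurable_C f.
Hypothesis f_eigen : {ae Q, forall x, f (T x) = lam * f x}.

Lemma ae_eigen_iter : {ae Q, forall x, forall i, f (iter i T x) = lam ^+ i * f x}.
Proof.
apply: filterS (ae_iter mT iQ f_eigen) => x fx; elim=> [|i ih].
  by rewrite expr0 mul1r.
by rewrite iterS fx ih exprS mulrA.
Qed.

Let measurable_normc_sqr : measurable_fun setT (fun x => normc (f x) ^+ 2).
Proof.
under eq_fun do rewrite sqr_normcE.
by case: mf => mRe mIm; apply: measurable_funD; exact: measurable_funX.
Qed.

Lemma expanding_eigenfunction_eq0 : 1 < normc lam -> {ae Q, forall x, f x = 0}.
Proof.
move=> lam1; have lam2 : 1 < normc lam ^+ 2 by rewrite exprn_egt1.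
have [a] := exists_prob_gt0_le Q measurable_normc_sqr; set D := [set x | _] => D0.
have mD : measurable D by exact: measurable_le_cst.
suff : {ae Q, forall x, normc (f x) ^+ 2 = 0}.
  by apply: filterS => x /eqP; rewrite sqrf_eq0 => /eqP/eq0_normc.
apply: ae_eq0_of_norm_lt => r r0; pose A := [set x | r <= normc (f x) ^+ 2].
have mA : measurable A by exact: measurable_ge_cst.
have [QA|A0] := leP (fine (Q A)) 0.
  exists A; split => //; first exact: fine_prob_le0.
  by move=> x /= /negP; rewrite -leNgt ger0_norm// sqr_ge0.
have [m lam_m] := exists_lt_exprn (a / r) lam2.
have mDm : measurable (iter m T @^-1` D) by exact: measurable_preimage_iter.
have Dm0 : 0 < fine (Q (iter m T @^-1` D)) by rewrite [Q _](invariant_prob_iter mT m iQ).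
have [i [meet_gt0 _]] := mixing_joint_recurrence mA mDm mDm A0 Dm0 Dm0.
have mAD : measurable (A `&` iter i T @^-1` (iter m T @^-1` D)).
  by apply: measurableI => //; exact: measurable_preimage_iter.
have [x [Ax Dx] fx] := ae_exists_prob_gt0 mAD meet_gt0 ae_eigen_iter.
have : normc (f (iter (m + i) T x)) ^+ 2 <= a by rewrite iterD; exact: Dx.
rewrite fx normcM normcX exprMn exprAC leNgt => /negP; case.
rewrite ltr_pdivrMr// in lam_m; apply: lt_le_trans lam_m _.
rewrite ler_pM ?exprn_ge0 ?normc_ge0 ?(ltW r0)//.
by rewrite ler_weXn2l ?leq_addr// ltW.
Qed.

Lemma contracting_eigenfunction_constant (g : Omega -> R) : normc lam <= 1 ->
  measurable_fun setT g -> (forall x y, `|g x - g y| <= normc (f x - f y)) ->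
  exists c, {ae Q, forall x, g x = c}.
Proof.
move=> lam1 mg gf; apply: exists_ae_constant => // a b ab Qa Qb.
have e0 : 0 < (b - a) / 2 by rewrite divr_gt0// subr_gt0.
have QT : 0 < fine (Q setT) by rewrite probability_setT.
have [mRe mIm] := mf.
have [B1 [mB1 _ B10 oscRe]] := exists_prob_gt0_small_oscillation measurableT QT mRe e0.
have [B [mB BB1 B0 oscIm]] := exists_prob_gt0_small_oscillation mB1 B10 mIm e0.
have ma := measurable_le_cst a mg; have mb := measurable_ge_cst b mg.
have [i [meeta meetb]] := mixing_joint_recurrence mB ma mb B0 Qa Qb.
have mBT C : measurable C -> measurable (B `&` iter i T @^-1` C).
  by move=> mC; apply: measurableI => //; exact: measurable_preimage_iter.
have [x [Bx gx] fx] := ae_exists_prob_gt0 (mBT _ ma) meeta ae_eigen_iter.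
have [y [By gy] fy] := ae_exists_prob_gt0 (mBT _ mb) meetb ae_eigen_iter.
have spread : b - a <= normc (f y - f x).
  apply: (@le_trans _ _ (normc (f (iter i T y) - f (iter i T x)))).
    apply: le_trans (gf _ _); apply: le_trans (ler_norm _).
    by apply: lerB; [exact: gy|exact: gx].
  rewrite fx fy -mulrBr normcM normcX.
  by rewrite ler_piMl ?normc_ge0// exprn_ile1 ?normc_ge0.
have := normcB_le (f y) (f x); have := oscRe _ _ (BB1 _ By) (BB1 _ Bx).
by have := oscIm _ _ By Bx; lra.
Qed.

End eigenfunction.

Lemma mixing_weakly_mixing : cap_weakly_mixing T (fun A => fine (Q A)).
Proof.
move=> f lam mf /cap_as_fine_prob fT.
have [lam1|lam1] := ltP 1 (normc lam).
  by exists 0; apply/cap_as_fine_prob; exact: expanding_eigenfunction_eq0 lam1.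
have [mRe mIm] := mf.
have [|a fa] := contracting_eigenfunction_constant mf fT lam1 mRe.
  by move=> x y; exact: norm_ReB_le_normc.
have [|b fb] := contracting_eigenfunction_constant mf fT lam1 mIm.
  by move=> x y; exact: norm_ImB_le_normc.
exists (a +i* b)%C; apply/cap_as_fine_prob; apply: filterS2 fa fb => x.
by case: (f x) => ? ? /= -> ->.
Qed.

End mixing_eigenfunctions.

Section null_invariant_sets.
Context {d : measure_display} {Omega : measurableType d} {R : realType}.
Variables (T : Omega -> Omega) (V : set Omega -> R) (Q : probability Omega R).
Hypotheses (uV : upper_probability V) (cQ : core V (fun A => fine (Q A))).
Implicit Types A : set Omega.

Lemma weakly_mixing_ergodic A : cap_weakly_mixing T V -> measurable A ->
  T @^-1` A = A -> V A = 0 \/ V (~` A) = 0.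
Proof.
move=> wV mA TA; have cV : capacity V by case: uV.
pose f x : R[i] := ((\1_A x : R) +i* 0)%C.
have [||c [N [mN [VN fc]]]] := wV f 1.
- by split => /=; [exact: measurable_indic|exact: measurable_cst].
- exists set0; split => //; split; first by case: cV.
  by move=> x _; rewrite mul1r /f -[in RHS]TA.
have [c1|c1] := eqVneq c 1; [right|left].
  apply: (capacity_sub_null cV _ mN _ VN); first exact: measurableC.
  move=> x nAx; apply: contrapT => /fc; rewrite c1 /f indicE memNset// => -[] /eqP.
  by rewrite eq_sym oner_eq0.
apply: (capacity_sub_null cV mA mN _ VN) => x Ax; apply: contrapT => /fc fxc.
by rewrite -fxc /f indicE mem_set// eqxx in c1.
Qed.

Lemma weakly_mixing_null_invariant A : cap_weakly_mixing T V -> measurable A ->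
  T @^-1` A = A -> Q A = 0%E -> V A = 0.
Proof.
move=> wV mA TA QA; have [//|VCA] := weakly_mixing_ergodic wV mA TA.
have := core_null cQ (measurableC mA) VCA.
by rewrite probability_setC// QA sube0 => /eqP; rewrite onee_eq0.
Qed.

Lemma mixing_null_invariant A : mixing_cond T V Q -> measurable A ->
  T @^-1` A = A -> Q A = 0%E -> V A = 0.
Proof.
move=> mixQ mA TA QA; have [P cP PA] := upper_probability_attained uV mA.
apply/eqP; rewrite eq_le (capacity_ge0 _ mA) ?andbT; last by case: uV.
rewrite leNgt; apply/negP => VA0.
have mixA : cesaro_mixing T Q (fun B => fine (P B)) setT A by exact: mixQ.
have [i dev_lt] := cesaro_mean_cvg0_exists_lt mixA (exprn_gt0 2 VA0).
move: dev_lt; rewrite setTI preimage_iter_invariant// PA QA mulr0 subr0.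
by rewrite real_normK ?num_real// ltxx.
Qed.

End null_invariant_sets.

Lemma decorrelated_mixing_cond {d : measure_display} {Omega : measurableType d}
    {R : realType} (T : Omega -> Omega) (V : set Omega -> R) (Q : probability Omega R) :
  measurable_fun setT T -> upper_probability V ->
  same_null_sets V (fun A => fine (Q A)) ->
  (forall C, measurable C -> decorrelated T Q C) -> mixing_cond T V Q.
Proof.
move=> mT uV VQ dQ P cP B C mB mC; have [P' PE] := core_probability uV cP.
have PQ : P' `<< Q.
  apply/null_content_dominatesP => N mN /(fine_prob_eq0 Q mN)/(VQ N mN) VN.
  by apply: (core_null _ mN VN); apply: fine_prob_core => A mA; rewrite PE// (core_le cP).
exact: (eq_cesaro_mixing mT mB mC PE) (decorrelated_cesaro_mixing mT PQ mB mC (dQ C mC)).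
Qed.

Theorem theorem5p8 (d : measure_display) (Omega : measurableType d) (R : realType)
  (T : Omega -> Omega) (V : set Omega -> R) :
  measurable_fun setT T ->
  upper_probability V ->
  cap_invariant T V ->
  [/\ (cap_weakly_mixing T V ->
        exists Q : probability Omega R,
          [/\ core V (fun A => fine (Q A)), weakly_mixing_prob T Q
            & mixing_cond T V Q]),
      ((exists Q : probability Omega R,
          [/\ core V (fun A => fine (Q A)), weakly_mixing_prob T Q
            & mixing_cond T V Q]) ->
        exists Q : probability Omega R,
          [/\ core V (fun A => fine (Q A)), invariant_prob T Q
            & mixing_cond T V Q])
    & ((exists Q : probability Omega R,
          [/\ core V (fun A => fine (Q A)), invariant_prob T Q
            & mixing_cond T V Q]) ->
        cap_weakly_mixing T V)].
Proof.
move=> mT uV iV; split.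
- move=> wV; have [Q cQ iQ] := core_invariant_probability mT uV iV.
  have VQ := upper_probability_same_null_sets mT uV iV cQ iQ
    (fun A => weakly_mixing_null_invariant uV cQ wV).
  have dQ C := weakly_mixing_decorrelated mT iQ
    (cap_weakly_mixing_same_null_sets VQ wV) (C := C).
  exists Q; split => //; first exact: decorrelated_weakly_mixing_prob.
  exact: decorrelated_mixing_cond VQ dQ.
- by move=> [Q [cQ [iQ _] mixQ]]; exists Q.
- move=> [Q [cQ iQ mixQ]].
  have VQ := upper_probability_same_null_sets mT uV iV cQ iQ
    (fun A => mixing_null_invariant uV mixQ).
  apply: cap_weakly_mixing_same_null_sets (mixing_weakly_mixing mT iQ (mixQ _ cQ)).
  by move=> N mN; rewrite VQ.
Qed.
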